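(* Let $R$ be a commutative Noetherian integral domain. Let $\mathcal T$ be a regular triangulated category with Rouquier dimension $n$, and let $F\colon\mathcal T\to D^b(R\text{-mod})$ be a triangulated functor such that the essential image of $F$ contains a family $\{M_i\}_{i\in I}$ of finitely generated $R$-modules. Suppose there exist an integer $d\ge 1$ and a family of $R$-modules $\{N_i\}_{i\in I}$ such that $\bigcap_{i\in I}\operatorname{ann}\operatorname{Ext}^d_R(M_i,N_i)=0$. Then $d\le n$.
   Context: $D^b(R\text{-mod})$ is the bounded derived category of finitely generated $R$-modules; a module is regarded as a complex concentrated in degree $0$. $\operatorname{ann}$ of an $R$-module is its annihilator ideal in $R$. For an object $G$ of a triangulated category $\mathcal T$: $[G]_0$ is the full subcategory of (objects isomorphic to) finite direct sums of shifts of $G$; for $k\ge 1$, $[G]_k$ is the full subcategory of objects $F$ for which there is a distinguished triangle $F_{k-1}\to F\to F_0\to F_{k-1}[1]$ with $F_0\in[G]_0$ and $F_{k-1}\in[G]_{k-1}$; and $\langle G\rangle_n$ is the full subcategory of direct summands in $\mathcal T$ of objects of $[G]_n$. A triangulated category $\mathcal T$ is regular if there are $G\in\mathcal T$ and $n$ with $\mathcal T=\langle G\rangle_n$; its Rouquier dimension is the minimal integer $n$ such that $\mathcal T=\langle G\rangle_n$ for some $G\in\mathcal T$. *)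

(* Defs.v *)
From HB Require Import structures.
From mathcomp Require Import all_boot all_order all_algebra.
From mathcomp Require Import boolp classical_sets functions.
From mathcomp Require multinomials.freeg.

Set Implicit Arguments.
Unset Strict Implicit.
Unset Printing Implicit Defensive.

Import Order.TTheory GRing.Theory Num.Theory.
Local Open Scope ring_scope.
#[local] Obligation Tactic := idtac.

Declare Scope tri_scope.
Delimit Scope tri_scope with tri.

(* The groups of morphisms are not packed as [zmodType]s: the morphisms of the
   derived category below live in a larger universe than the carriers of
   MathComp's algebraic structures. *)
Record preadd_cat := PreaddCat {
  ob :> Type;
  hom : ob -> ob -> Type;
  idm : forall X, hom X X;
  cmp : forall X Y Z, hom Y Z -> hom X Y -> hom X Z;
  hzero : forall X Y, hom X Y;
  hopp : forall X Y, hom X Y -> hom X Y;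
  hadd : forall X Y, hom X Y -> hom X Y -> hom X Y;
  cmpA : forall X Y Z W (h : hom Z W) (g : hom Y Z) (f : hom X Y),
    cmp h (cmp g f) = cmp (cmp h g) f;
  cmp1f : forall X Y (f : hom X Y), cmp (idm Y) f = f;
  cmpf1 : forall X Y (f : hom X Y), cmp f (idm X) = f;
  haddA : forall X Y (f g h : hom X Y), hadd f (hadd g h) = hadd (hadd f g) h;
  haddC : forall X Y (f g : hom X Y), hadd f g = hadd g f;
  hadd0f : forall X Y (f : hom X Y), hadd (hzero X Y) f = f;
  haddNf : forall X Y (f : hom X Y), hadd (hopp f) f = hzero X Y;
  cmpDl : forall X Y Z (g1 g2 : hom Y Z) (f : hom X Y),
    cmp (hadd g1 g2) f = hadd (cmp g1 f) (cmp g2 f);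
  cmpDr : forall X Y Z (g : hom Y Z) (f1 f2 : hom X Y),
    cmp g (hadd f1 f2) = hadd (cmp g f1) (cmp g f2)
}.

Arguments hom {C} X Y : rename.
Arguments idm {C} X : rename.
Arguments hzero {C} X Y : rename.

Notation "g '\oc' f" := (cmp g f)
  (at level 40, left associativity) : tri_scope.
Notation "f '\+c' g" := (hadd f g)
  (at level 50, left associativity) : tri_scope.
Local Open Scope tri_scope.

Record add_functor (C D : preadd_cat) := AddFunctor {
  fob :> C -> D;
  fmor : forall X Y : C, hom X Y -> hom (fob X) (fob Y);
  fmor1 : forall X, fmor (idm X) = idm (fob X);
  fmorM : forall X Y Z (g : hom Y Z) (f : hom X Y),
    fmor (g \oc f) = fmor g \oc fmor f;
  fmorD : forall X Y (f g : hom X Y), fmor (f \+c g) = fmor f \+c fmor g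
}.

Definition is_iso (C : preadd_cat) (X Y : C) (f : hom X Y) :=
  exists g : hom Y X, g \oc f = idm X /\ f \oc g = idm Y.

Definition isomorphic (C : preadd_cat) (X Y : C) :=
  exists f : hom X Y, is_iso f.

Definition is_zero_object (C : preadd_cat) (Z : C) :=
  forall X : C, (forall f : hom X Z, f = hzero X Z) /\
                (forall f : hom Z X, f = hzero Z X).

Definition is_biproduct (C : preadd_cat) (X Y S : C) :=
  exists (i1 : hom X S) (i2 : hom Y S) (p1 : hom S X) (p2 : hom S Y),
    [/\ p1 \oc i1 = idm X, p2 \oc i2 = idm Y,
        p1 \oc i2 = hzero Y X, p2 \oc i1 = hzero X Y
      & (i1 \oc p1) \+c (i2 \oc p2) = idm S].

Record tri_data := TriData {
  tcat :> preadd_cat;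
  shift : add_functor tcat tcat;
  dist : forall X Y Z : tcat,
    hom X Y -> hom Y Z -> hom Z (shift X) -> Prop
}.

Arguments shift {T} : rename.

Definition iso_triangles (T : tri_data) (X Y Z X' Y' Z' : T)
    (u : hom X Y) (v : hom Y Z) (w : hom Z (shift X))
    (u' : hom X' Y') (v' : hom Y' Z') (w' : hom Z' (shift X')) :=
  exists (a : hom X X') (b : hom Y Y') (c : hom Z Z'),
    [/\ is_iso a, is_iso b & is_iso c] /\
    [/\ b \oc u = u' \oc a, c \oc v = v' \oc b
      & fmor shift a \oc w = w' \oc c].

Record triangulated (T : tri_data) : Prop := Triangulated {
  tr_zero : exists Z : T, is_zero_object Z;
  tr_biproduct : forall X Y : T, exists S, is_biproduct X Y S;
  tr_shift_ff : forall (X Y : T) (g : hom (shift X) (shift Y)),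
    exists! f : hom X Y, fmor shift f = g;
  tr_shift_surj : forall Y : T, exists X, isomorphic (shift X) Y;
  (* TR1 *)
  tr_dist_iso : forall (X Y Z X' Y' Z' : T)
      (u : hom X Y) (v : hom Y Z) (w : hom Z (shift X))
      (u' : hom X' Y') (v' : hom Y' Z') (w' : hom Z' (shift X')),
    iso_triangles u v w u' v' w' -> dist u v w -> dist u' v' w';
  tr_dist_id : forall X Z : T, is_zero_object Z ->
    dist (idm X) (hzero X Z) (hzero Z (shift X));
  tr_dist_cone : forall (X Y : T) (u : hom X Y),
    exists (Z : T) (v : hom Y Z) (w : hom Z (shift X)), dist u v w;
  (* TR2 *)
  tr_rotate : forall (X Y Z : T)
      (u : hom X Y) (v : hom Y Z) (w : hom Z (shift X)),
    dist u v w <-> dist v w (hopp (fmor shift u));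
  (* TR3 *)
  tr_morphism : forall (X Y Z X' Y' Z' : T)
      (u : hom X Y) (v : hom Y Z) (w : hom Z (shift X))
      (u' : hom X' Y') (v' : hom Y' Z') (w' : hom Z' (shift X'))
      (a : hom X X') (b : hom Y Y'),
    dist u v w -> dist u' v' w' -> b \oc u = u' \oc a ->
    exists c : hom Z Z',
      c \oc v = v' \oc b /\ fmor shift a \oc w = w' \oc c;
  (* TR4 *)
  tr_octahedron : forall (X Y Z A B C : T) (f : hom X Y) (g : hom Y Z)
      (a1 : hom Y A) (a2 : hom A (shift X))
      (b1 : hom Z B) (b2 : hom B (shift Y))
      (c1 : hom Z C) (c2 : hom C (shift X)),
    dist f a1 a2 -> dist g b1 b2 -> dist (g \oc f) c1 c2 ->
    exists (u : hom A C) (v : hom C B),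
      [/\ dist u v (fmor shift a1 \oc b2),
          u \oc a1 = c1 \oc g, c2 \oc u = a2,
          v \oc c1 = b1 & b2 \oc v = fmor shift f \oc c2]
}.

Record tri_functor (S T : tri_data) := TriFunctor {
  tfun :> add_functor S T;
  tf_xi : forall X : S, hom (tfun (shift X)) (shift (tfun X));
  tf_xi_iso : forall X, is_iso (tf_xi X);
  tf_xi_nat : forall (X Y : S) (f : hom X Y),
    tf_xi Y \oc fmor tfun (fmor shift f)
    = fmor shift (fmor tfun f) \oc tf_xi X;
  tf_dist : forall (X Y Z : S)
      (u : hom X Y) (v : hom Y Z) (w : hom Z (shift X)),
    dist u v w ->
    dist (fmor tfun u) (fmor tfun v) (tf_xi X \oc fmor tfun w)
}.

Definition in_ess_image (C D : preadd_cat) (F : add_functor C D) (Y : D) :=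
  exists X : C, isomorphic (F X) Y.

(* [is_shift_of i G H] : H is isomorphic to G[i].  The shift being an
   equivalence, H[k+1] isomorphic to G says that H is isomorphic to
   G[-(k+1)]. *)
Definition is_shift_of (T : tri_data) (i : int) (G H : T) :=
  match i with
  | Posz k => isomorphic (iter k (@shift T) G) H
  | Negz k => isomorphic (iter k.+1 (@shift T) H) G
  end.

Inductive sum_of_shifts (T : tri_data) (G : T) : T -> Prop :=
| sum_of_no_shift S : is_zero_object S -> sum_of_shifts G S
| sum_of_more_shifts i X Y S : is_shift_of i G X -> sum_of_shifts G Y ->
    is_biproduct X Y S -> sum_of_shifts G S.

(* [G]_k *)
Fixpoint ext_of_shifts (T : tri_data) (G : T) (k : nat) (F : T) : Prop :=
  match k with
  | 0 => sum_of_shifts G F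
  | k'.+1 => exists (F' F0 : T)
      (u : hom F' F) (v : hom F F0) (w : hom F0 (shift F')),
      [/\ dist u v w, sum_of_shifts G F0 & ext_of_shifts G k' F']
  end.

(* <G>_n *)
Definition generated (T : tri_data) (G : T) (n : nat) (X : T) :=
  exists X' S : T, is_biproduct X X' S /\ ext_of_shifts G n S.

Definition generates (T : tri_data) (G : T) (n : nat) :=
  forall X : T, generated G n X.

Definition regular (T : tri_data) :=
  exists (G : T) (n : nat), generates G n.

Definition rouquier_dim (T : tri_data) (n : nat) :=
  (exists G : T, generates G n) /\
  (forall m, (exists G : T, generates G m) -> (n <= m)%N).

Definition fin_gen (R : comNzRingType) (V : lmodType R) :=
  exists (k : nat) (g : 'I_k -> V),
    forall v : V, exists c : 'I_k -> R, v = \sum_(i < k) c i *: g i.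

Lemma fin_gen_prod (R : comNzRingType) (U V : lmodType R) :
  fin_gen U -> fin_gen V -> fin_gen (U * V)%type.
Proof.
move=> [k [g hg]] [l [h hh]].
exists (k + l)%N, (fun i => match fintype.split i with
                            | inl i => (g i, 0) | inr j => (0, h j) end).
move=> [x y]; have [c ->] := hg x; have [e ->] := hh y.
exists (fun i => match fintype.split i with inl i => c i | inr j => e j end).
have pairE (I : finType) (u : I -> U) (v : I -> V) :
    \sum_i ((u i, v i) : (U * V)%type) = (\sum_i u i, \sum_i v i).
  by elim/big_rec3: _ => // i a b z _ ->.
rewrite big_split_ord /=.
rewrite (eq_bigr (fun i => ((c i *: g i, 0) : (U * V)%type))); last first.
  move=> i _; rewrite -[lshift _ _]/(unsplit (inl i)) unsplitK.
  by congr pair; rewrite /= scaler0.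
rewrite [X in _ = _ + X](eq_bigr (fun i => ((0, e i *: h i) : (U * V)%type)));
    last first.
  move=> i _; rewrite -[rshift _ _]/(unsplit (inr i)) unsplitK.
  by congr pair; rewrite /= scaler0.
rewrite !pairE; congr pair => /=; first by rewrite [X in _ + X]big1 ?addr0.
by rewrite [X in X + _]big1 ?add0r.
Qed.

Definition ideal (R : comNzRingType) (I : set R) :=
  [/\ I 0, forall x y, I x -> I y -> I (x + y)
    & forall a x, I x -> I (a * x)].

Definition noetherian (R : comNzRingType) :=
  forall I : set R, ideal I ->
    exists (k : nat) (g : 'I_k -> R),
      (forall i, I (g i)) /\
      (forall x, I x -> exists c : 'I_k -> R, x = \sum_(i < k) c i * g i).

Definition ann (R : comNzRingType) (V : lmodType R) : set R :=
  [set r | forall v : V, r *: v = 0].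

Section Complexes.
Variable R : comNzRingType.

Record bcomplex := BComplex {
  cx :> int -> lmodType R;
  df : forall n : int, {linear cx n -> cx (n + 1)};
  df_df : forall n (x : cx n), df (n + 1) (df n x) = 0;
  cx_fg : forall n, fin_gen (cx n);
  cx_bounded : exists a b : int,
    forall n, (n < a) || (b < n) -> forall x : cx n, x = 0
}.

Record chain_map (X Y : bcomplex) := ChainMap {
  cm :> forall n : int, {linear X n -> Y n};
  cm_df : forall n (x : X n), cm (n + 1) (df X n x) = df Y n (cm n x)
}.

(* Since d has degree +1 and every integer is of the form n + 1, this says
   that all the maps H^(n+1)(f) are injective (first half) and surjective
   (second half). *)
Definition quasi_iso (X Y : bcomplex) (f : chain_map X Y) :=
  forall n : int,
    (forall x : X (n + 1), df X (n + 1) x = 0 ->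
       (exists y : Y n, f (n + 1) x = df Y n y) ->
       exists x' : X n, x = df X n x') /\
    (forall y : Y (n + 1), df Y (n + 1) y = 0 ->
       exists x : X (n + 1), df X (n + 1) x = 0 /\
       exists y' : Y n, y = f (n + 1) x + df Y n y').

Program Definition chain_id (X : bcomplex) : chain_map X X :=
  @ChainMap X X (fun n => idfun) _.
Next Obligation. by []. Qed.

Program Definition chain_comp (X Y Z : bcomplex)
    (g : chain_map Y Z) (f : chain_map X Y) : chain_map X Z :=
  @ChainMap X Z (fun n => g n \o f n) _.
Next Obligation. by move=> X Y Z g f n x /=; rewrite !cm_df. Qed.

Program Definition chain_add (X Y : bcomplex) (f g : chain_map X Y) :
    chain_map X Y :=
  @ChainMap X Y (fun n => f n \+ g n) _.
Next Obligation. by move=> X Y f g n x /=; rewrite !cm_df linearD. Qed.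

Program Definition cx_shift (X : bcomplex) : bcomplex :=
  @BComplex (fun n => X (n + 1)) (fun n => \- df X (n + 1)) _ _ _.
Next Obligation. by move=> X n x /=; rewrite linearN df_df !oppr0. Qed.
Next Obligation. by move=> X n; exact: cx_fg. Qed.
Next Obligation.
move=> X; have [a [b h]] := cx_bounded X.
exists (a - 1), (b - 1) => n hn; apply: h.
by rewrite -ltrBrDr -[b < _]ltrBlDr.
Qed.

Program Definition chain_shift (X Y : bcomplex) (f : chain_map X Y) :
    chain_map (cx_shift X) (cx_shift Y) :=
  @ChainMap (cx_shift X) (cx_shift Y) (fun n => f (n + 1)) _.
Next Obligation. by move=> X Y f n x /=; rewrite linearN cm_df. Qed.

Lemma quasi_iso_shift (X Y : bcomplex) (f : chain_map X Y) :
  quasi_iso f -> quasi_iso (chain_shift f).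
Proof.
move=> hf n; have [inj sur] := hf (n + 1); split => [x|y] /= /eqP.
  rewrite oppr_eq0 => /eqP dx [y fx]; case: (inj x dx).
    by exists (- y); rewrite linearN.
  by move=> x' ->; exists (- x'); rewrite linearN opprK.
rewrite oppr_eq0 => /eqP dy; case: (sur y dy) => x [dx [y' ->]].
exists x; split; first by rewrite dx oppr0.
by exists (- y'); rewrite linearN opprK.
Qed.

Section Cone.
Variables (X Y : bcomplex) (f : chain_map X Y).

Definition cone_mod (n : int) : lmodType R := (X (n + 1)%R * Y n)%type.

Definition cone_df (n : int) (z : cone_mod n) : cone_mod (n + 1) :=
  (- df X (n + 1) z.1, f (n + 1) z.1 + df Y n z.2).

Lemma cone_df_linear n : linear (@cone_df n).
Proof.
move=> a x y; rewrite /cone_df; congr pair => /=.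
  by rewrite linearP opprD scalerN.
by rewrite !linearP scalerDr addrACA.
Qed.

HB.instance Definition _ n :=
  GRing.isLinear.Build R (cone_mod n) (cone_mod (n + 1)) *:%R (@cone_df n)
    (@cone_df_linear n).

Program Definition cone : bcomplex :=
  @BComplex cone_mod (fun n => @cone_df n) _ _ _.
Next Obligation.
move=> n x; rewrite /cone_df /=; congr pair.
  by rewrite linearN df_df !oppr0.
by rewrite linearD df_df addr0 linearN cm_df addNr.
Qed.
Next Obligation.
by move=> n; apply: fin_gen_prod; exact: cx_fg.
Qed.
Next Obligation.
have [a [b h]] := cx_bounded X; have [a' [b' h']] := cx_bounded Y.
exists (Num.min (a - 1) a'), (Num.max b b') => n hn [x y]; congr pair.
  apply: h; case/orP: hn.
    by rewrite lt_min => /andP[na _]; rewrite -ltrBrDr na.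
  rewrite gt_max => /andP[bn _].
  by rewrite (lt_trans bn) ?orbT // ltrDl.
apply: h'; case/orP: hn; first by rewrite lt_min => /andP[_ ->].
by rewrite gt_max => /andP[_ ->]; rewrite orbT.
Qed.

Definition cone_inr (n : int) (y : Y n) : cone_mod n := (0, y).
Definition cone_fst (n : int) (z : cone_mod n) : X (n + 1) := z.1.

Lemma cone_inr_linear n : linear (@cone_inr n).
Proof. by move=> a x y; congr pair; rewrite /= ?scaler0 ?addr0. Qed.

Lemma cone_fst_linear n : linear (@cone_fst n).
Proof. by []. Qed.

HB.instance Definition _ n :=
  GRing.isLinear.Build R (Y n) (cone_mod n) *:%R (@cone_inr n)
    (@cone_inr_linear n).
HB.instance Definition _ n :=
  GRing.isLinear.Build R (cone_mod n) (X (n + 1)) *:%R (@cone_fst n)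
    (@cone_fst_linear n).

Program Definition cone_in : chain_map Y cone :=
  @ChainMap Y cone (fun n => @cone_inr n) _.
Next Obligation.
by move=> n y; rewrite /cone_inr /= /cone_df /= !linear0 add0r.
Qed.

Program Definition cone_out : chain_map cone (cx_shift X) :=
  @ChainMap cone (cx_shift X) (fun n => @cone_fst n) _.
Next Obligation. by []. Qed.

End Cone.

Definition stalk_mod (M : lmodType R) (n : int) : lmodType R :=
  match n with Posz 0 => M | _ => 'rV[R]_0 end.

Program Definition stalk (M : lmodType R) (hM : fin_gen M) : bcomplex :=
  @BComplex (stalk_mod M) (fun n => \0) _ _ _.
Next Obligation. by []. Qed.
Next Obligation.
have h0 : fin_gen 'rV[R]_0.
  exists 0%N, (fun _ => 0) => v; exists (fun _ => 0).
  by rewrite big_ord0 thinmx0.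
by move=> M hM [[|n]|n] //=.
Qed.
Next Obligation.
move=> M hM; exists 0, 0 => -[[|n]|n] //= _ x; exact: thinmx0.
Qed.

(* The localization of the category of bounded complexes at the
   quasi-isomorphisms, by generators and relations: the morphisms are the
   formal expressions in chain maps and formal inverses of quasi-isomorphisms,
   modulo the congruence [dexpr_eq].  Sums are taken as additional formal
   operations, with the relations making the localization functor additive;
   since quasi-isomorphisms are stable under finite direct sums, the
   localization of the category of complexes is additive, and this changes
   neither its morphisms nor its universal property for additive functors. *)
Inductive dexpr : bcomplex -> bcomplex -> Type :=
| DGen X Y (f : chain_map X Y) : dexpr X Y
| DInv X Y (s : chain_map X Y) (hs : quasi_iso s) : dexpr Y X
| DCmp X Y Z (g : dexpr Y Z) (f : dexpr X Y) : dexpr X Z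
| DZero X Y : dexpr X Y
| DOpp X Y (f : dexpr X Y) : dexpr X Y
| DAdd X Y (f g : dexpr X Y) : dexpr X Y.

Inductive dexpr_eq : forall X Y, dexpr X Y -> dexpr X Y -> Prop :=
| deq_refl X Y (f : dexpr X Y) : dexpr_eq f f
| deq_sym X Y (f g : dexpr X Y) : dexpr_eq f g -> dexpr_eq g f
| deq_trans X Y (f g h : dexpr X Y) :
    dexpr_eq f g -> dexpr_eq g h -> dexpr_eq f h
| deq_cmp X Y Z (g g' : dexpr Y Z) (f f' : dexpr X Y) :
    dexpr_eq g g' -> dexpr_eq f f' -> dexpr_eq (DCmp g f) (DCmp g' f')
| deq_opp X Y (f f' : dexpr X Y) :
    dexpr_eq f f' -> dexpr_eq (DOpp f) (DOpp f')
| deq_add X Y (f f' g g' : dexpr X Y) :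
    dexpr_eq f f' -> dexpr_eq g g' -> dexpr_eq (DAdd f g) (DAdd f' g')
| deq_cmpA X Y Z W (h : dexpr Z W) (g : dexpr Y Z) (f : dexpr X Y) :
    dexpr_eq (DCmp h (DCmp g f)) (DCmp (DCmp h g) f)
| deq_cmp1f X Y (f : dexpr X Y) : dexpr_eq (DCmp (DGen (chain_id Y)) f) f
| deq_cmpf1 X Y (f : dexpr X Y) : dexpr_eq (DCmp f (DGen (chain_id X))) f
| deq_addA X Y (f g h : dexpr X Y) :
    dexpr_eq (DAdd f (DAdd g h)) (DAdd (DAdd f g) h)
| deq_addC X Y (f g : dexpr X Y) : dexpr_eq (DAdd f g) (DAdd g f)
| deq_add0f X Y (f : dexpr X Y) : dexpr_eq (DAdd (DZero X Y) f) f
| deq_addNf X Y (f : dexpr X Y) : dexpr_eq (DAdd (DOpp f) f) (DZero X Y)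
| deq_cmpDl X Y Z (g1 g2 : dexpr Y Z) (f : dexpr X Y) :
    dexpr_eq (DCmp (DAdd g1 g2) f) (DAdd (DCmp g1 f) (DCmp g2 f))
| deq_cmpDr X Y Z (g : dexpr Y Z) (f1 f2 : dexpr X Y) :
    dexpr_eq (DCmp g (DAdd f1 f2)) (DAdd (DCmp g f1) (DCmp g f2))
| deq_gen_ext X Y (f g : chain_map X Y) :
    (forall n x, f n x = g n x) -> dexpr_eq (DGen f) (DGen g)
| deq_gen_comp X Y Z (g : chain_map Y Z) (f : chain_map X Y) :
    dexpr_eq (DGen (chain_comp g f)) (DCmp (DGen g) (DGen f))
| deq_gen_add X Y (f g : chain_map X Y) :
    dexpr_eq (DGen (chain_add f g)) (DAdd (DGen f) (DGen g))
| deq_invl X Y (s : chain_map X Y) (hs : quasi_iso s) :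
    dexpr_eq (DCmp (DInv hs) (DGen s)) (DGen (chain_id X))
| deq_invr X Y (s : chain_map X Y) (hs : quasi_iso s) :
    dexpr_eq (DCmp (DGen s) (DInv hs)) (DGen (chain_id Y)).

(* The elements are the equivalence classes of [dexpr_eq]. *)
Definition dhom (X Y : bcomplex) :=
  {P : dexpr X Y -> Prop | exists e, P = dexpr_eq e}.

Definition dpi (X Y : bcomplex) (e : dexpr X Y) : dhom X Y :=
  exist _ (dexpr_eq e) (ex_intro _ e erefl).

Definition drepr (X Y : bcomplex) (f : dhom X Y) : dexpr X Y :=
  projT1 (cid (projT2 f)).

Lemma dpiP (X Y : bcomplex) (e e' : dexpr X Y) :
  dpi e = dpi e' <-> dexpr_eq e e'.
Proof.
split=> [h|h].
  have : dexpr_eq e' = dexpr_eq e by exact/esym/(congr1 sval h).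
  by move/(congr1 (fun P => P e')) => <-; exact: deq_refl.
apply: eq_exist; apply/funext => x; apply/propext.
by split; apply: deq_trans => //; exact: deq_sym.
Qed.

Lemma dreprK (X Y : bcomplex) (f : dhom X Y) : dpi (drepr f) = f.
Proof.
case: f => P h; rewrite /drepr /=; case: cid => e /= he.
by apply: eq_exist; rewrite he.
Qed.

Lemma drepr_dpi (X Y : bcomplex) (e : dexpr X Y) : dexpr_eq (drepr (dpi e)) e.
Proof. by apply/dpiP; rewrite dreprK. Qed.

Lemma dhom_ind (X Y : bcomplex) (P : dhom X Y -> Prop) :
  (forall e, P (dpi e)) -> forall f, P f.
Proof. by move=> h f; rewrite -(dreprK f). Qed.

Definition dcmp (X Y Z : bcomplex) (g : dhom Y Z) (f : dhom X Y) : dhom X Z :=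
  dpi (DCmp (drepr g) (drepr f)).
Definition dopp (X Y : bcomplex) (f : dhom X Y) : dhom X Y :=
  dpi (DOpp (drepr f)).
Definition dadd (X Y : bcomplex) (f g : dhom X Y) : dhom X Y :=
  dpi (DAdd (drepr f) (drepr g)).

Lemma dcmpE (X Y Z : bcomplex) (g : dexpr Y Z) (f : dexpr X Y) :
  dcmp (dpi g) (dpi f) = dpi (DCmp g f).
Proof. by apply/dpiP; apply: deq_cmp; exact: drepr_dpi. Qed.

Lemma doppE (X Y : bcomplex) (f : dexpr X Y) : dopp (dpi f) = dpi (DOpp f).
Proof. by apply/dpiP; apply: deq_opp; exact: drepr_dpi. Qed.

Lemma daddE (X Y : bcomplex) (f g : dexpr X Y) :
  dadd (dpi f) (dpi g) = dpi (DAdd f g).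
Proof. by apply/dpiP; apply: deq_add; exact: drepr_dpi. Qed.

Program Definition Db_cat : preadd_cat :=
  @PreaddCat bcomplex dhom (fun X => dpi (DGen (chain_id X))) dcmp
    (fun X Y => dpi (DZero X Y)) dopp dadd _ _ _ _ _ _ _ _ _.
Next Obligation.
move=> X Y Z W; elim/dhom_ind=> h; elim/dhom_ind=> g; elim/dhom_ind=> f.
by rewrite !dcmpE; apply/dpiP; exact: deq_cmpA.
Qed.
Next Obligation.
move=> X Y; elim/dhom_ind=> f; rewrite dcmpE; apply/dpiP; exact: deq_cmp1f.
Qed.
Next Obligation.
move=> X Y; elim/dhom_ind=> f; rewrite dcmpE; apply/dpiP; exact: deq_cmpf1.
Qed.
Next Obligation.
move=> X Y; elim/dhom_ind=> f; elim/dhom_ind=> g; elim/dhom_ind=> h.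
by rewrite !daddE; apply/dpiP; exact: deq_addA.
Qed.
Next Obligation.
move=> X Y; elim/dhom_ind=> f; elim/dhom_ind=> g.
by rewrite !daddE; apply/dpiP; exact: deq_addC.
Qed.
Next Obligation.
move=> X Y; elim/dhom_ind=> f; rewrite daddE; apply/dpiP; exact: deq_add0f.
Qed.
Next Obligation.
move=> X Y; elim/dhom_ind=> f; rewrite doppE daddE; apply/dpiP.
exact: deq_addNf.
Qed.
Next Obligation.
move=> X Y Z; elim/dhom_ind=> g1; elim/dhom_ind=> g2; elim/dhom_ind=> f.
by rewrite !(daddE, dcmpE); apply/dpiP; exact: deq_cmpDl.
Qed.
Next Obligation.
move=> X Y Z; elim/dhom_ind=> g; elim/dhom_ind=> f1; elim/dhom_ind=> f2.
by rewrite !(daddE, dcmpE); apply/dpiP; exact: deq_cmpDr.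
Qed.

(* The localization functor on morphisms; on objects it is the identity. *)
Definition Db_of (X Y : bcomplex) (f : chain_map X Y) :
  @hom Db_cat X Y := dpi (DGen f).

Fixpoint dexpr_shift (X Y : bcomplex) (e : dexpr X Y) :
    dexpr (cx_shift X) (cx_shift Y) :=
  match e with
  | DGen _ _ f => DGen (chain_shift f)
  | DInv _ _ s hs => DInv (quasi_iso_shift hs)
  | DCmp _ _ _ g f => DCmp (dexpr_shift g) (dexpr_shift f)
  | DZero X Y => DZero (cx_shift X) (cx_shift Y)
  | DOpp _ _ f => DOpp (dexpr_shift f)
  | DAdd _ _ f g => DAdd (dexpr_shift f) (dexpr_shift g)
  end.

Lemma dexpr_shift_id (X : bcomplex) :
  dexpr_eq (DGen (chain_shift (chain_id X))) (DGen (chain_id (cx_shift X))).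
Proof. exact: deq_gen_ext. Qed.

Lemma dexpr_shift_eq (X Y : bcomplex) (e e' : dexpr X Y) :
  dexpr_eq e e' -> dexpr_eq (dexpr_shift e) (dexpr_shift e').
Proof.
elim=> {X Y e e'} /=; try by econstructor; eauto.
- move=> X Y f; apply: deq_trans _ (deq_cmp1f _).
  by apply: deq_cmp (dexpr_shift_id _) (deq_refl _).
- move=> X Y f; apply: deq_trans _ (deq_cmpf1 _).
  by apply: deq_cmp (deq_refl _) (dexpr_shift_id _).
- by move=> X Y f g h; apply: deq_gen_ext => n x; exact: h.
- move=> X Y Z g f; apply: deq_trans _ (deq_gen_comp _ _).
  exact: deq_gen_ext.
- move=> X Y f g; apply: deq_trans _ (deq_gen_add _ _); exact: deq_gen_ext.
- move=> X Y s hs.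
  exact: deq_trans (deq_invl _) (deq_sym (dexpr_shift_id _)).
- move=> X Y s hs.
  exact: deq_trans (deq_invr _) (deq_sym (dexpr_shift_id _)).
Qed.

Program Definition Db_shift : add_functor Db_cat Db_cat :=
  @AddFunctor Db_cat Db_cat cx_shift
    (fun X Y (f : dhom X Y) => dpi (dexpr_shift (drepr f))) _ _ _.
Next Obligation.
move=> X; apply/dpiP; apply: deq_trans _ (dexpr_shift_id _).
exact: (dexpr_shift_eq (drepr_dpi _)).
Qed.
Next Obligation.
move=> X Y Z g f; rewrite /cmp /= dcmpE; apply/dpiP.
exact: (dexpr_shift_eq (drepr_dpi _)).
Qed.
Next Obligation.
move=> X Y f g; rewrite /hadd /= daddE; apply/dpiP.
exact: (dexpr_shift_eq (drepr_dpi _)).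
Qed.

(* The triangles isomorphic to A -f-> B -> cone f -> A[1], for f a chain map *)
Definition Db_dist (X Y Z : Db_cat)
    (u : hom X Y) (v : hom Y Z) (w : hom Z (Db_shift X)) : Prop :=
  exists (A B : bcomplex) (f : chain_map A B)
    (a : @hom Db_cat X A) (b : @hom Db_cat Y B) (c : @hom Db_cat Z (cone f)),
    [/\ is_iso a, is_iso b & is_iso c] /\
    [/\ b \oc u = Db_of f \oc a, c \oc v = Db_of (cone_in f) \oc b
      & fmor Db_shift a \oc w = Db_of (cone_out f) \oc c].

Definition Db : tri_data := @TriData Db_cat Db_shift Db_dist.

End Complexes.

Local Open Scope classical_set_scope.
Local Open Scope quotient_scope.
Section SubQuotient.
Variables (R : comNzRingType) (V : lmodType R).

Record submodule := Submodule {
  sm_set :> set V;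
  sm_closed : submod_closed [pred x | x \in sm_set]
}.

Variable S : submodule.

Definition sm_pred : pred V := [pred x | x \in (S : set V)].

HB.instance Definition _ := GRing.isSubmodClosed.Build R V sm_pred
  (GRing.submod_closed_semi (sm_closed S)).

Lemma sm_predE x : (x \in sm_pred) = (x \in (S : set V)).
Proof. by []. Qed.

HB.instance Definition _ := GRing.isOppClosed.Build V sm_pred
  (GRing.zmod_closedN (GRing.submod_closedB (sm_closed S))).

Record sub_mod := SubMod { sub_val :> V; sub_valP : sub_val \in sm_pred }.
HB.instance Definition _ := [isSub for sub_val].
HB.instance Definition _ := [Choice of sub_mod by <:].
HB.instance Definition _ := [SubChoice_isSubLmodule of sub_mod by <:].

Definition sm_equiv (x y : V) : bool := x - y \in sm_pred.

Lemma sm_equiv_is_equiv : equiv_class_of sm_equiv.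
Proof.
split=> [x|x y|y x z]; rewrite /sm_equiv.
- by rewrite subrr rpred0.
- by rewrite -opprB rpredN.
- by move=> xy yz; rewrite -(subrKA y) rpredD.
Qed.

Canonical sm_equiv_equiv := EquivRelPack sm_equiv_is_equiv.
Canonical sm_equiv_encModRel := defaultEncModRel sm_equiv.

Definition quo_mod := {eq_quot sm_equiv}.
HB.instance Definition _ := Choice.on quo_mod.
HB.instance Definition _ : EqQuotient V sm_equiv quo_mod := EqQuotient.on quo_mod.

Definition quo_pi (x : V) : quo_mod := \pi_quo_mod x.

Lemma quo_piP x y : quo_pi x = quo_pi y <-> (x - y) \in (S : set V).
Proof. by split=> [/eqmodP|h]; last exact/eqmodP. Qed.

Lemma quo_reprP x : (repr (quo_pi x) - x) \in sm_pred.
Proof. by apply/quo_piP; rewrite /quo_pi reprK. Qed.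

Definition quo_add (x y : quo_mod) := quo_pi (repr x + repr y).
Definition quo_opp (x : quo_mod) := quo_pi (- repr x).
Definition quo_scale (a : R) (x : quo_mod) := quo_pi (a *: repr x).

Lemma quo_addE x y : quo_add (quo_pi x) (quo_pi y) = quo_pi (x + y).
Proof.
by apply/quo_piP; rewrite -sm_predE opprD addrACA rpredD // quo_reprP.
Qed.

Lemma quo_oppE x : quo_opp (quo_pi x) = quo_pi (- x).
Proof. by apply/quo_piP; rewrite -sm_predE -opprD rpredN quo_reprP. Qed.

Lemma quo_scaleE a x : quo_scale a (quo_pi x) = quo_pi (a *: x).
Proof. by apply/quo_piP; rewrite -sm_predE -scalerBr rpredZ ?quo_reprP. Qed.

Lemma quo_ind (P : quo_mod -> Prop) : (forall x, P (quo_pi x)) -> forall x, P x.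
Proof. by move=> h x; have := h (repr x); rewrite /quo_pi reprK. Qed.

Lemma quo_addA : associative quo_add.
Proof.
elim/quo_ind=> x; elim/quo_ind=> y; elim/quo_ind=> z.
by rewrite !quo_addE addrA.
Qed.

Lemma quo_addC : commutative quo_add.
Proof.
by elim/quo_ind=> x; elim/quo_ind=> y; rewrite !quo_addE addrC.
Qed.

Lemma quo_add0 : left_id (quo_pi 0) quo_add.
Proof. by elim/quo_ind=> x; rewrite quo_addE add0r. Qed.

Lemma quo_addN : left_inverse (quo_pi 0) quo_opp quo_add.
Proof. by elim/quo_ind=> x; rewrite quo_oppE quo_addE addNr. Qed.

HB.instance Definition _ :=
  GRing.isZmodule.Build quo_mod quo_addA quo_addC quo_add0 quo_addN.

Lemma quo_scaleA a b x : quo_scale a (quo_scale b x) = quo_scale (a * b) x.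
Proof. by elim/quo_ind: x => x; rewrite !quo_scaleE scalerA. Qed.

Lemma quo_scale1 : left_id 1 quo_scale.
Proof. by elim/quo_ind=> x; rewrite quo_scaleE scale1r. Qed.

Lemma quo_scaleDr : right_distributive quo_scale +%R.
Proof.
move=> a; elim/quo_ind=> x; elim/quo_ind=> y.
rewrite [in LHS]/GRing.add /= [in RHS]/GRing.add /= quo_addE.
by rewrite !quo_scaleE quo_addE scalerDr.
Qed.

Lemma quo_scaleDl x : {morph quo_scale^~ x : a b / a + b}.
Proof.
elim/quo_ind: x => x a b.
by rewrite [in RHS]/GRing.add /= !quo_scaleE quo_addE scalerDl.
Qed.

HB.instance Definition _ := GRing.Zmodule_isLmodule.Build R quo_mod
  quo_scaleA quo_scale1 quo_scaleDr quo_scaleDl.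

End SubQuotient.

Section Ext.
Variable R : comNzRingType.

Definition projective (P : lmodType R) :=
  forall (A B : lmodType R) (g : {linear A -> B}) (h : {linear P -> B}),
    (forall b, exists a, g a = b) ->
    exists k : {linear P -> A}, forall x, g (k x) = h x.

Record proj_resolution (M : lmodType R) := ProjResolution {
  pr_mod :> nat -> lmodType R;
  pr_df : forall n, {linear pr_mod n.+1 -> pr_mod n};
  pr_aug : {linear pr_mod 0 -> M};
  pr_proj : forall n, projective (pr_mod n);
  pr_aug_surj : forall m, exists x, pr_aug x = m;
  pr_exact0 : forall x, pr_aug x = 0 <-> exists y, pr_df 0 y = x;
  pr_exactS : forall n (x : pr_mod n.+1),
    pr_df n x = 0 <-> exists y, pr_df n.+1 y = x
}.

Section Existence.
Import multinomials.freeg.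

Lemma free_cover (M : lmodType R) :
  exists (P : lmodType R) (p : {linear P -> M}),
    projective P /\ forall m, exists x, p x = m.
Proof.
have lin (V : lmodType R) (f : M -> V) :
    exists k : {linear {freeg M / R} -> V}, forall m, k << m >> = f m.
  have kl : linear (fglift f).
    pose l : {additive {freeg M / R} -> V} :=
      HB.pack (fglift f) (GRing.isZmodMorphism.Build _ _ (fglift f)
                            (lift_is_additive f)).
    have lZ a D : l (a *: D) = a *: l D.
      rewrite -[in RHS](freeg_sumE D) [in RHS](raddf_sum l) scaler_sumr.
      rewrite -[a *: D]/(fgscale a D) /fgscale (raddf_sum l).
      by apply: eq_bigr => x _; rewrite /= !liftU scalerA.
    by move=> a D E; rewrite -[LHS]/(l _) (raddfD l) lZ.
  pose k : {linear {freeg M / R} -> V} :=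
    HB.pack (fglift f) (GRing.isLinear.Build R _ _ _ (fglift f) kl).
  by exists k => m; rewrite /k /= liftU scale1r.
have [p hp] := lin M id.
exists {freeg M / R}, p; split; last by move=> m; exists << m >>.
move=> A B g h gs.
have [f hf] : exists f : M -> A, forall m, g (f m) = h << m >>.
  exists (fun m => projT1 (cid (gs (h << m >>)))) => m.
  by case: cid.
have [k hk] := lin A f; exists k => D.
rewrite -(freeg_sumE D) !raddf_sum /=; apply: eq_bigr => m _.
have -> : << coeff m D *g m >> = coeff m D *: << m >> :> {freeg M / R}.
  apply/eqP/freeg_eqP => x; rewrite coeffZ !coeffU; by rewrite mul1r.
by rewrite !linearZ /= hk hf.
Qed.

End Existence.

Program Definition kernel (U V : lmodType R) (f : {linear U -> V}) :
  submodule U := @Submodule R U [set x | f x = 0] _.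
Next Obligation.
move=> U V f; split; first by rewrite inE /= linear0.
move=> a x y; rewrite !inE /= => fx fy.
by rewrite linearP fx fy scaler0 addr0.
Qed.

Lemma proj_resolution_exists (M : lmodType R) : inhabited (proj_resolution M).
Proof.
pose cov (V : lmodType R) := cid (free_cover V).
pose F (V : lmodType R) := projT1 (cov V).
pose p (V : lmodType R) : {linear F V -> V} := projT1 (cid (projT2 (cov V))).
have pP V : projective (F V) /\ forall m, exists x, p V x = m.
  exact: projT2 (cid (projT2 (cov V))).
pose fix K (n : nat) : lmodType R :=
  match n with
  | 0 => M
  | n'.+1 => sub_mod (kernel (p (K n')))
  end.
pose d n : {linear F (K n.+1) -> F (K n)} :=
  (\val : {linear sub_mod (kernel (p (K n))) -> F (K n)}) \o p (K n.+1).
have ex n x : p (K n) x = 0 <-> exists y, d n y = x.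
  split=> [px|[y <-]]; last first.
    by have := sub_valP (p (K n.+1) y); rewrite sm_predE inE.
  have xk : x \in sm_pred (kernel (p (K n))) by rewrite sm_predE inE.
  have [y hy] := (pP (K n.+1)).2 (SubMod xk).
  by exists y; rewrite /d /= hy.
have exS n x : d n x = 0 <-> exists y, d n.+1 y = x.
  rewrite -ex; split=> [h|h]; last by rewrite /d /= h.
  exact: val_inj.
split; apply: (@ProjResolution M (fun n => F (K n)) d (p M)) => //.
- by move=> n; exact: (pP _).1.
- exact: (pP M).2.
- exact: (ex 0%N).
Qed.

(* A projective resolution fixed once and for all: Ext does not depend on it,
   up to isomorphism. *)
Definition std_resolution (M : lmodType R) : proj_resolution M :=
  projT1 (cid (let: inhabits P := proj_resolution_exists M in
               ex_intro (fun=> True) P I)).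

Section ExtOf.
Variables (M N : lmodType R) (P : proj_resolution M) (d : nat).

(* The d-cocycles and d-coboundaries of Hom_R(P, N); the former is a
   submodule of the module of all functions P_d -> N. *)
Definition is_cocycle : set (P d -> N) :=
  [set phi | linear phi /\ forall x, phi (pr_df P d x) = 0].

Definition is_coboundary (phi : P d -> N) : Prop :=
  match d return (P d -> N) -> Prop with
  | 0 => fun phi => phi = 0
  | e.+1 => fun phi => exists psi : {linear P e -> N},
      forall x, phi x = psi (pr_df P e x)
  end phi.

Program Definition cocycles : submodule (P d -> N : lmodType R) :=
  @Submodule R _ is_cocycle _.
Next Obligation.
split; first by rewrite inE; split=> // a x y; rewrite scaler0 addr0.
move=> a f g; rewrite !inE => -[fl f0] [gl g0]; split.
  move=> b x y; rewrite !fctE /= fl gl !scalerDr !scalerA (mulrC a b).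
  by rewrite addrACA.
by move=> x; rewrite !fctE /= f0 g0 scaler0 addr0.
Qed.

Lemma is_coboundary_closed a (phi psi : P d -> N) :
  is_coboundary phi -> is_coboundary psi -> is_coboundary (a *: phi + psi).
Proof.
rewrite /is_coboundary; case: d phi psi => [|e] phi psi.
  by move=> -> ->; rewrite scaler0 addr0.
move=> [u hu] [v hv]; exists (a \*: u \+ v) => x.
by rewrite !fctE /= hu hv.
Qed.

Program Definition coboundaries : submodule (sub_mod cocycles) :=
  @Submodule R _ [set phi | is_coboundary (sub_val phi)] _.
Next Obligation.
split; last by move=> a f g; rewrite !inE; exact: is_coboundary_closed.
by rewrite inE /= /is_coboundary; case: d => [|e] //; exists \0.
Qed.

Definition Ext_of : lmodType R := quo_mod coboundaries.

End ExtOf.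

Definition Ext (d : nat) (M N : lmodType R) : lmodType R :=
  Ext_of N (std_resolution M) d.

End Ext.

(* Main.v *)
From HB Require Import structures.
From mathcomp Require Import all_boot all_order all_algebra.
From mathcomp Require Import boolp classical_sets.
From mathcomp Require Import zify.
Require Import Defs.

Set Implicit Arguments.
Unset Strict Implicit.
Unset Printing Implicit Defensive.

Import Order.TTheory GRing.Theory Num.Theory.
Local Open Scope ring_scope.
Local Open Scope classical_set_scope.
Local Open Scope tri_scope.
#[local] Obligation Tactic := idtac.

(** If T is generated by G in n steps, every M_i is a summand of an object built
    from shifts of F(G) by n cones, and the Ext groups of the M_i beyond degree
    n are killed by one and the same non-zero scalar.  This is a ghost lemma
    up to torsion.

    The contravariant test functors are the groups [X, E] of homotopy classes
    of maps from a bounded complex X to a complex E of injective modules.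
    Quasi-isomorphisms act bijectively on them, so they are functors on the
    derived category; being defined on its morphisms by recursion on formal
    expressions, they need no calculus of fractions.  A cone gives an exact
    sequence ([dist_exact]).  A chain map E -> E' is a ghost if it sends
    cocycles to coboundaries, i.e. is zero on cohomology.

    Over a Noetherian domain, a bounded complex X of finitely generated modules
    is a sum of shifts of free modules up to torsion.  Hence there is a single
    s <> 0 such that s times a ghost is zero on [X, E], for all ghosts
    ([kills_ghost]).  By the exact sequences, each further cone costs one more
    ghost and one more factor s: s^(n+1) times a composite of n+1 ghosts is
    zero on [F(A), E] for every A in T ([kills_generated]).

    On the other hand, let N -> J_0 -> J_1 -> ... be an injective resolution.
    The inclusion of the truncation J_(k+1) -> J_(k+2) -> ... into
    J_k -> J_(k+1) -> ... is a ghost, since the sequence is exact at J_(k+1),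
    and Ext^d(M, N) is the image of [M, -] under a composite of d of these
    ghosts ([lifts_of_kills], and [dimension_shift] to pass to a projective
    resolution of M).  If n < d, then s^(n+1) kills Ext^d(M_i, N_i) for all i,
    which contradicts the hypothesis on the annihilators.

    All the injective complexes used are constant: the same module E in every
    degree, with the same differential.  The complex J is replaced by the
    product of all its shifts, whose module is the product of the J_j; this
    loses nothing because [X, -] commutes with products, and it removes the
    degrees of the target from every formula.  That a constant complex is
    unbounded does no harm, because the sources are bounded. *)

(** * Extension of additive maps into a divisible group *)

Lemma int_subgroup_principal (H : int -> Prop) :
  H 0 -> (forall c x y, H x -> H y -> H (x - y * c)) ->
  exists m : nat, forall n, H n <-> (m%:Z %| n)%Z.
Proof.
move=> H0 HB.
have HM x c : H x -> H (x * c).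
  by move=> hx; have := HB (- c) _ _ H0 hx; rewrite mulrN opprK add0r.
have [[m0 [m0gt Hm0]]|none] := pselect (exists m : nat, (0 < m)%N /\ H m%:Z).
  have ex : exists m : nat, (0 < m)%N && `[< H m%:Z >].
    by exists m0; rewrite m0gt; apply/asboolP.
  case: (ex_minnP ex) => m /andP[mgt /asboolP Hm] mmin; exists m => n; split.
    move=> Hn; apply/dvdz_mod0P.
    have Hr : H (n %% m)%Z.
      have := HB (n %/ m)%Z _ _ Hn Hm.
      by rewrite {1}(divz_eq n m) mulrC addrAC subrr add0r.
    have m0z : m%:Z != 0 by rewrite -lt0n.
    have := ltz_mod n m0z; have := modz_ge0 n m0z.
    case: (n %% m)%Z Hr => // r Hr _ /= rlt.
    apply/eqP; rewrite eqz_nat -leqn0 leqNgt; apply/negP => rgt.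
    have := mmin r; rewrite rgt (asboolT Hr) => /(_ isT).
    by rewrite leqNgt; move: rlt; rewrite ltz_nat => ->.
  by move=> /dvdzP[q ->]; rewrite mulrC; exact: HM.
exists 0%N => n; rewrite dvd0z; split=> [Hn|/eqP -> //].
apply/negPn/negP => n0; apply: none; exists `|n|%N.
split; first by rewrite absz_gt0.
case: (lerP 0 n) => hn; first by rewrite gez0_abs.
by rewrite ltz0_abs //; have := HM _ (-1) Hn; rewrite mulrN1.
Qed.

Lemma subgroup_mulz (V : zmodType) (S : set V) x (n : int) :
  S 0 -> (forall x y, S x -> S y -> S (x - y)) -> S x -> S (x *~ n).
Proof.
move=> S0 SB Sx.
have SN y : S y -> S (- y) by move=> Sy; rewrite -sub0r; exact: SB.
have SM (k : nat) : S (x *+ k).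
  elim: k => [|k ih]; first by rewrite mulr0n.
  by rewrite mulrSr -[x in _ + x]opprK; apply: SB => //; exact: SN.
by case: n => n; [exact: SM | exact: (SN _ (SM n.+1))].
Qed.

(** Extension of additive maps is proved for their graphs, to which Zorn's lemma
    applies directly: a union of a chain of graphs is a graph. *)
Section AdditiveGraphs.
Variables B D : zmodType.
Implicit Types G : set (B * D).

Definition additive_graph G :=
  [/\ G 0, forall g h, G g -> G h -> G (g - h)
    & forall y, G (0, y) -> y = 0].

Lemma additive_graph_fun G x y y' :
  additive_graph G -> G (x, y) -> G (x, y') -> y = y'.
Proof.
move=> [_ GB G0] gy gy'; apply/eqP; rewrite -subr_eq0; apply/eqP/G0.
by have := GB _ _ gy gy'; rewrite -[_ - _]/(x - x, y - y') subrr.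
Qed.

Lemma additive_graph_mulz G x y (n : int) :
  additive_graph G -> G (x, y) -> G (x *~ n, y *~ n).
Proof.
move=> [G0 GB _] gxy; have -> : (x *~ n, y *~ n) = (x, y) *~ n.
  by rewrite [RHS]surjective_pairing !raddfMz.
exact: subgroup_mulz.
Qed.

Hypothesis divisible :
  forall (m : nat) (x : D), (0 < m)%N -> exists y, y *+ m = x.

(** The integers n with n b in the domain are the multiples of some m.  The
    value y at b has only to satisfy m y = x, where x is the value at m b,
    and divisibility provides such a y. *)
Lemma additive_graph_extend G b : additive_graph G ->
  exists G', [/\ additive_graph G', G `<=` G' & exists y, G' (b, y)].
Proof.
move=> gG; have [G0 GB G00] := gG.
have [m hm] : exists m : nat, forall n : int,
    (exists y, G (b *~ n, y)) <-> (m%:Z %| n)%Z.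
  apply: int_subgroup_principal; first by exists 0; rewrite mulr0z.
  move=> c x y [u gu] [v gv]; exists (u - v *~ c).
  have := GB _ _ gu (additive_graph_mulz c gG gv).
  by rewrite -mulrzA mulrzBr.
have [x gx] := (hm m%:Z).2 (dvdzz _).
have [y yx] : exists y, y *~ m%:Z = x.
  case: (posnP m) => [m0|/divisible]; last exact.
  (* no non-zero multiple of b lies in the domain: any value will do *)
  by exists 0; move: gx; rewrite m0 mulr0z mul0rz => /G00 ->.
exists [set p | exists g n, G g /\ p = g + (b *~ n, y *~ n)]; split; last first.
- by exists y, 0, 1; rewrite !mulr1z add0r.
- by move=> g gg; exists g, 0; rewrite !mulr0z addr0.
split.
- by exists 0, 0; rewrite !mulr0z addr0.
- move=> _ _ [g [n [gg ->]]] [h [k [gh ->]]]; exists (g - h), (n - k).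
  split; first exact: GB.
  by rewrite !mulrzBr opprD addrACA.
- move=> z [[g1 g2] [n [gg [/esym/eqP e1 ->]]]].
  have gn : G (b *~ n, - g2).
    have := GB _ _ G0 gg; rewrite sub0r -[- _]/(- g1, - g2).
    by move: e1; rewrite addrC addr_eq0 => /eqP ->.
  have /dvdzP[q nq] := (hm n).1 (ex_intro _ _ gn).
  have : - g2 = y *~ n.
    apply: (additive_graph_fun gG gn); rewrite nq mulrC !mulrzA.
    by rewrite yx; exact: additive_graph_mulz.
  by move=> <-; rewrite subrr.
Qed.

Lemma additive_graph_total G : additive_graph G ->
  exists f : {additive B -> D}, forall x y, G (x, y) -> f x = y.
Proof.
move=> gG.
(* the empty set is admitted because it is the union of the empty chain *)
pose P X := X = set0 \/ (G `<=` X /\ additive_graph X).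
have [A [PA Amax]] : exists A, P A /\ forall X, A `<` X -> ~ P X.
  apply: Zorn_bigcup => F FP Ftot.
  have [[p [X0 FX0 X0p]]|none] := pselect (exists p, (\bigcup_(X in F) X) p);
    last by left; apply/seteqP; split=> // p hp; apply: none; exists p.
  have good X p' : F X -> X p' -> G `<=` X /\ additive_graph X.
    by move=> FX Xp; case: (FP _ FX) => // X00; rewrite X00 in Xp.
  have [GX0 gX0] := good _ _ FX0 X0p.
  right; split; first by move=> g gg; exists X0 => //; exact: GX0.
  split.
  - by exists X0 => //; case: gX0.
  - move=> g h [X FX Xg] [Y FY Yh].
    have [_ [_ XB _]] := good _ _ FX Xg; have [_ [_ YB _]] := good _ _ FY Yh.
    case: (Ftot _ _ FX FY) => XY; last first.
      by exists X => //; apply: XB => //; exact: XY.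
    by exists Y => //; apply: YB => //; exact: XY.
  - by move=> y [X FX Xy]; have [_ [_ _ X0']] := good _ _ FX Xy; exact: X0'.
have [GA gA] : G `<=` A /\ additive_graph A.
  case: PA => // A0; exfalso; apply: (Amax G); last by right; split.
  have G0 : G 0 by case: gG.
  by rewrite A0; split=> // /(_ _ G0).
have dom b : exists y, A (b, y).
  apply: contrapT => nb.
  have [A' [gA' AA' [y A'y]]] := additive_graph_extend b gA.
  apply: (Amax A'); last by right; split=> //; exact: subset_trans AA'.
  by split=> // /(_ _ A'y) hy; apply: nb; exists y.
pose f b := projT1 (cid (dom b)).
have Af b : A (b, f b) by rewrite /f; case: cid.
have fB : {morph f : x y / x - y}.
  move=> x y; apply: (additive_graph_fun gA (Af _)).
  by have [_ AB _] := gA; exact: (AB _ _ (Af x) (Af y)).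
pose k : {additive B -> D} := HB.pack f (GRing.isZmodMorphism.Build _ _ f fB).
by exists k => x y /GA Gxy; apply: (additive_graph_fun gA (Af _)).
Qed.

End AdditiveGraphs.

(** * Characters with values in the rationals modulo the integers *)

(** The witness is Q/Z, and 1/m is the m-torsion element; for m = 0, where the
    torsion condition is empty, 1/2 is a non-zero element. *)
Lemma divisible_cogenerator :
  exists D : zmodType,
    (forall (m : nat) (x : D), (0 < m)%N -> exists y, y *+ m = x) /\
    (forall m : nat, m != 1%N -> exists x : D, x != 0 /\ x *+ m = 0).
Proof.
have closed : zmod_closed (fun x : rat => x \is a Num.int).
  by split; [exact: rpred0 | move=> x y; exact: rpredB].
pose Z : zmodClosed rat :=
  HB.pack (fun x : rat => x \is a Num.int)
    (GRing.isZmodClosed.Build rat _ closed).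
pose D := Quotient.quot Z.
pose p : {additive rat -> D} := \pi_D%qT.
have p0 x : (p x == 0) = (x \is a Num.int).
  by rewrite -(raddf0 p) /p /= -Quotient.idealrBE subr0.
have unit_frac m x : (0 < m)%N -> p x = p (x / m%:R) *+ m.
  move=> m0; rewrite -raddfMn /= -[_ / _ *+ m]mulr_natr divfK //.
  by rewrite pnatr_eq0 -lt0n.
exists D; split.
  move=> m; elim/quotW => x m0; exists (p (x / m%:R)).
  by rewrite -unit_frac.
move=> [|[|m]] // _.
  by exists (p (1 / 2%:R)); rewrite mulr0n p0; split.
exists (p (1 / m.+2%:R)); rewrite -unit_frac // p0; split; last first.
  by apply/eqP; rewrite p0 rpred1.
apply/negP => /intrP[n /eqP]; rewrite eq_sym -subr_eq0 => /eqP e.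
have : (n * m.+2%:Z)%:~R = 1 :> rat.
  move/eqP: e; rewrite subr_eq0 => /eqP e.
  by rewrite intrM e divfK // pnatr_eq0.
move/eqP; rewrite -[1]/(1%:~R) eqr_int => /eqP nm.
have := dvdz_mull n (dvdzz m.+2%:Z); by rewrite nm dvdz1.
Qed.

Definition QZ : zmodType := projT1 (cid divisible_cogenerator).

Lemma QZ_divisible (m : nat) (x : QZ) : (0 < m)%N -> exists y, y *+ m = x.
Proof. exact: (projT2 (cid divisible_cogenerator)).1. Qed.

Lemma QZ_torsion (m : nat) : m != 1%N -> exists x : QZ, x != 0 /\ x *+ m = 0.
Proof. exact: (projT2 (cid divisible_cogenerator)).2. Qed.

Lemma character_factor (A B : zmodType) (d : {additive A -> B})
    (f : {additive A -> QZ}) : (forall x, d x = 0 -> f x = 0) ->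
  exists g : {additive B -> QZ}, forall x, g (d x) = f x.
Proof.
move=> df; pose G : set (B * QZ) := [set p | exists x, p = (d x, f x)].
have [|g hg] := additive_graph_total QZ_divisible (G := G); last first.
  by exists g => x; apply: hg; exists x.
split; first by exists 0; rewrite !raddf0.
- by move=> _ _ [x ->] [y ->]; exists (x - y); rewrite !raddfB.
- by move=> y [x [e ->]]; exact: df.
Qed.

(** If m generates the ideal of the integers n with n v in S, then m is not 1,
    and sending v to a non-zero element killed by m is consistent with sending
    S to 0. *)
Lemma character_separate (V : zmodType) (S : set V) (v : V) :
  S 0 -> (forall x y, S x -> S y -> S (x - y)) -> ~ S v ->
  exists f : {additive V -> QZ}, (forall x, S x -> f x = 0) /\ f v <> 0.
Proof.
move=> S0 SB nSv.
have SZ x (n : int) : S x -> S (x *~ n) by exact: subgroup_mulz.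
have [m hm] : exists m : nat, forall n : int, S (v *~ n) <-> (m%:Z %| n)%Z.
  apply: int_subgroup_principal; first by rewrite mulr0z.
  by move=> c x y Sx Sy; rewrite mulrzBr mulrzA; apply: SB => //; exact: SZ.
have m1 : m != 1%N.
  by apply/eqP => m1; apply: nSv; rewrite -[v]mulr1z; apply/hm; rewrite m1.
have [q [q0 qm]] := QZ_torsion m1.
pose G : set (V * QZ) := [set p | exists s n, S s /\ p = (s + v *~ n, q *~ n)].
have [|f hf] := additive_graph_total QZ_divisible (G := G); last first.
  exists f; split.
    by move=> x Sx; apply: hf; exists x, 0; rewrite !mulr0z addr0.
  have -> : f v = q by apply: hf; exists 0, 1; rewrite !mulr1z add0r.
  exact/eqP.
split; first by exists 0, 0; rewrite !mulr0z addr0.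
- move=> _ _ [s [n [Ss ->]]] [t [k [St ->]]]; exists (s - t), (n - k).
  by split; [exact: SB | rewrite !mulrzBr addrACA -opprD].
- move=> y [s [n [Ss [/esym/eqP]]]]; rewrite addr_eq0 => /eqP e ->.
  have /hm/dvdzP[k ->] : S (v *~ n).
    by rewrite -[v *~ n]opprK -e -sub0r; exact: SB.
  by rewrite mulrC mulrzA -pmulrn qm mul0rz.
Qed.

(** The character module of V, with R acting through V.  The law
    (a + b) f = a f + b f needs the additivity of f, so this module cannot be
    carried by all functions. *)
Section Characters.
Variables (R : comNzRingType) (V : lmodType R).

Record character := Character {
  char_fun :> V -> QZ;
  char_subproof : {morph char_fun : x y / x - y}
}.

HB.instance Definition _ := gen_eqMixin character.
HB.instance Definition _ := gen_choiceMixin character.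
HB.instance Definition _ (f : character) :=
  GRing.isZmodMorphism.Build V QZ f (@char_subproof f).

Lemma character_ext (f g : character) : (forall x, f x = g x) -> f = g.
Proof.
case: f g => [f hf] [g hg] /= fg.
have e : f = g by exact/funext.
by case: _ / e in hg fg *; congr Character; exact: Prop_irrelevance.
Qed.

Program Definition char_zero := @Character (fun=> 0) _.
Next Obligation. by move=> x y; rewrite subrr. Qed.
Program Definition char_opp (f : character) := @Character (fun x => - f x) _.
Next Obligation. by move=> f x y /=; rewrite raddfB opprD. Qed.
Program Definition char_add (f g : character) :=
  @Character (fun x => f x + g x) _.
Next Obligation. by move=> f g x y /=; rewrite !raddfB opprD addrACA. Qed.
Program Definition char_scale (a : R) (f : character) :=
  @Character (fun x => f (a *: x)) _.
Next Obligation. by move=> a f x y /=; rewrite scalerBr raddfB. Qed.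

Lemma char_addA : associative char_add.
Proof. by move=> f g h; apply: character_ext => x /=; rewrite addrA. Qed.
Lemma char_addC : commutative char_add.
Proof. by move=> f g; apply: character_ext => x /=; rewrite addrC. Qed.
Lemma char_add0 : left_id char_zero char_add.
Proof. by move=> f; apply: character_ext => x /=; rewrite add0r. Qed.
Lemma char_addN : left_inverse char_zero char_opp char_add.
Proof. by move=> f; apply: character_ext => x /=; rewrite addNr. Qed.

HB.instance Definition _ :=
  GRing.isZmodule.Build character char_addA char_addC char_add0 char_addN.

Lemma char_scaleA a b f : char_scale a (char_scale b f) = char_scale (a * b) f.
Proof. by apply: character_ext => x /=; rewrite scalerA mulrC. Qed.
Lemma char_scale1 : left_id 1 char_scale.
Proof. by move=> f; apply: character_ext => x /=; rewrite scale1r. Qed.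
Lemma char_scaleDr : right_distributive char_scale +%R.
Proof. by move=> a f g; apply: character_ext. Qed.
Lemma char_scaleDl f : {morph char_scale^~ f : a b / a + b}.
Proof.
by move=> a b; apply: character_ext => x /=; rewrite scalerDl raddfD.
Qed.

HB.instance Definition _ := GRing.Zmodule_isLmodule.Build R character
  char_scaleA char_scale1 char_scaleDr char_scaleDl.

Lemma char_addE (f g : character) x : (f + g) x = f x + g x.
Proof. by []. Qed.
Lemma char_scaleE a (f : character) x : (a *: f) x = f (a *: x).
Proof. by []. Qed.

End Characters.

Section SubmoduleClosure.
Variables (R : comNzRingType) (V : lmodType R) (S : submodule V).

Lemma submod0 : sm_set S 0.
Proof. by have := (sm_closed S).1; rewrite inE. Qed.

Lemma submodP a x y : sm_set S x -> sm_set S y -> sm_set S (a *: x + y).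
Proof. by move=> Sx Sy; have := (sm_closed S).2 a x y; rewrite !inE; apply. Qed.

Lemma submodZ a x : sm_set S x -> sm_set S (a *: x).
Proof.
by move=> Sx; rewrite -[_ *: _]addr0; apply: submodP => //; exact: submod0.
Qed.

Lemma submodB x y : sm_set S x -> sm_set S y -> sm_set S (x - y).
Proof. by move=> Sx Sy; rewrite addrC -scaleN1r; exact: submodP. Qed.

Lemma submod_sum (I : Type) (r : seq I) (c : I -> R) (w : I -> V) :
  (forall i, sm_set S (w i)) -> sm_set S (\sum_(i <- r) c i *: w i).
Proof.
move=> Sw; elim/big_rec: _ => [|i x _ Sx]; first exact: submod0.
exact: submodP.
Qed.

End SubmoduleClosure.

(** * Injective modules *)

Section Modules.
Variable R : comNzRingType.
Implicit Types A B V : lmodType R.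

Definition lin_of A B (f : A -> B) (hf : linear f) : {linear A -> B} :=
  HB.pack f (GRing.isLinear.Build R A B *:%R f hf).

Program Definition lin_range A B (f : {linear A -> B}) : submodule B :=
  @Submodule R B [set y | exists x, f x = y] _.
Next Obligation.
move=> A B f; split; first by rewrite inE; exists 0; rewrite linear0.
move=> a x y; rewrite !inE => -[u <-] [v <-].
by exists (a *: u + v); rewrite linearP.
Qed.

(** Projectivity is stated for surjections; here h only has to take its values
    in the range of g, and both maps are corestricted to this range. *)
Lemma projective_lift (P A B : lmodType R) (g : {linear A -> B})
    (h : {linear P -> B}) : projective P -> (forall x, exists a, g a = h x) ->
  exists k : {linear P -> A}, forall x, g (k x) = h x.
Proof.
move=> pP gh.
have in_range (C : lmodType R) (f : {linear C -> B}) x :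
    (exists a, g a = f x) -> f x \in sm_pred (lin_range g).
  by rewrite sm_predE inE.
pose corestr (C : lmodType R) (f : {linear C -> B}) fg x :=
  SubMod (in_range C f x (fg x)).
have lin C f fg : linear (corestr C f fg).
  by move=> a x y; apply: val_inj; rewrite /= linearP.
have gg x : exists a, g a = g x by exists x.
have [|k hk] := pP A _ (lin_of (lin A g gg)) (lin_of (lin P h gh)).
  move=> [y hy]; have := hy; rewrite sm_predE inE => -[x gx].
  by exists x; apply: val_inj.
by exists k => x; have /(congr1 val) := hk x.
Qed.

(** Extension along maps d that need not be injective: f has to vanish on the
    kernel of d.  This is equivalent to the usual property, and it is the form
    in which a homotopy is extended by one degree. *)
Definition injective_mod (E : lmodType R) :=
  forall A B (d : {linear A -> B}) (f : {linear A -> E}),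
    (forall x, d x = 0 -> f x = 0) ->
    exists g : {linear B -> E}, forall x, g (d x) = f x.

(** Hom(A, B^+) and Hom(B, A^+) are both the balanced biadditive maps from A and
    B to Q/Z. *)
Program Definition char_swap_fun A B (f : A -> character B)
    (hf : linear f) (b : B) : character A :=
  @Character R A (fun a => f a b) _.
Next Obligation.
by move=> A B f hf b x y; rewrite -[f]/(lin_of hf : _ -> _) linearB.
Qed.

Lemma char_swap_linear A B (f : A -> character B) (hf : linear f) :
  linear (char_swap_fun hf).
Proof.
move=> r x y; apply: character_ext => a /=.
rewrite raddfD; congr (_ + _).
by rewrite -[RHS]/(f (r *: a) x) -[f]/(lin_of hf : _ -> _) linearZ.
Qed.

Definition char_swap A B (f : {linear A -> character B}) :
    {linear B -> character A} :=
  lin_of (char_swap_linear (fun a x y => linearP f a x y)).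

Program Definition char_pull_fun A B (d : {linear A -> B}) (f : character B) :
  character A := @Character R A (fun x => f (d x)) _.
Next Obligation. by move=> A B d f x y; rewrite !raddfB. Qed.

Lemma char_pull_linear A B (d : {linear A -> B}) : linear (char_pull_fun d).
Proof.
move=> r f g; apply: character_ext => x.
by rewrite !(char_addE, char_scaleE) /= linearZ.
Qed.

(** Exchanging the arguments turns the extension of A -> P^+ along A -> B into
    the lifting of P -> A^+ through B^+ -> A^+; the lift exists pointwise since
    Q/Z is injective, and P is projective. *)
Lemma injective_character (P : lmodType R) :
  projective P -> injective_mod (character P).
Proof.
move=> pP A B d f df.
have [|k hk] := projective_lift (g := lin_of (char_pull_linear d)) 
                  (h := char_swap f) pP.
  move=> x; have [a da|g hg] := @character_factor A B d (char_swap f x).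
    by rewrite /= df.
  by exists (@Character R B g (raddfB g)); apply: character_ext.
exists (char_swap k) => a; apply: character_ext => x.
by have /(congr1 (fun c : character A => c a)) := hk x.
Qed.

(** A projective cover F of the characters that vanish on S gives a map
    V -> F^+; its kernel consists of the elements on which all these characters
    vanish, and characters separate elements from S.  Prescribing the kernel
    avoids quotient modules: with S the range of the preceding map, this is one
    step of an injective resolution. *)
Lemma injective_with_kernel V (S : submodule V) :
  exists Jf : {J : lmodType R & {linear V -> J}},
    injective_mod (projT1 Jf) /\ forall v, projT2 Jf v = 0 <-> sm_set S v.
Proof.
have pc : submod_closed [pred f : character V |
    f \in [set f : character V | forall v, sm_set S v -> f v = 0]].
  split; first by rewrite inE.
  move=> a f g; rewrite !inE /= => f0 g0 v Sv.
  by rewrite -[LHS]/(f (a *: v) + g v) g0 // addr0 f0 //; exact: submodZ.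
have [F [p [pF ps]]] := free_cover (sub_mod (Submodule pc)).
pose q : {linear F -> character V} :=
  (\val : {linear sub_mod (Submodule pc) -> character V}) \o p.
exists (existT (fun J : lmodType R => {linear V -> J})
          (character F) (char_swap q)); split.
  exact: injective_character.
move=> v /=; split=> [f0|Sv]; last first.
  apply: character_ext => x /=.
  by have := sub_valP (p x); rewrite sm_predE inE; apply.
apply: contrapT => nSv.
have [f [fS fv]] := character_separate (submod0 S) (@submodB _ _ S) nSv.
apply: fv; pose c := @Character R V f (raddfB f).
have cP : c \in sm_pred (Submodule pc) by rewrite sm_predE inE.
have [x hx] := ps (SubMod cP).
by have /(congr1 (fun h : character F => h x)) := f0; rewrite /= hx.
Qed.

Record inj_sequence := InjSequence {
  is_mod :> nat -> lmodType R;
  is_df : forall j, {linear is_mod j -> is_mod j.+1};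
  is_inj : forall j, injective_mod (is_mod j);
  is_exact : forall j (x : is_mod j.+1),
    is_df j.+1 x = 0 <-> exists y, is_df j y = x
}.

Lemma injective_resolution (N : lmodType R) :
  exists (J : inj_sequence) (e : {linear N -> J 0}),
    (forall x, e x = 0 -> x = 0) /\
    forall x, is_df J 0 x = 0 <-> exists y, e y = x.
Proof.
pose hull (VS : {V : lmodType R & submodule V}) :=
  cid (injective_with_kernel (projT2 VS)).
pose zero : submodule N := kernel (idfun : {linear N -> N}).
pose fix K (n : nat) : {V : lmodType R & submodule V} :=
  match n with
  | 0 => existT _ N zero
  | n'.+1 => existT _ _ (lin_range (projT2 (projT1 (hull (K n')))))
  end.
pose V n := projT1 (K n).
pose d n : {linear V n -> V n.+1} := projT2 (projT1 (hull (K n))).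
have Vinj n : injective_mod (V n.+1) by exact: (projT2 (hull (K n))).1.
have ker n v : d n v = 0 <-> sm_set (projT2 (K n)) v.
  exact: (projT2 (hull (K n))).2.
exists (@InjSequence (fun n => V n.+1) (fun n => d n.+1) Vinj
          (fun n => ker n.+2)), (d 0%N).
by split=> [x /(ker 0%N)|x]; last exact: (ker 1%N).
Qed.

(** The truncation J_1 -> J_2 -> ..., which resolves the first cosyzygy. *)
Definition inj_tail (J : inj_sequence) : inj_sequence :=
  @InjSequence (fun j => J j.+1) (fun j => is_df J j.+1)
    (fun j => @is_inj J j.+1) (fun j => @is_exact J j.+1).

End Modules.

(** * Maps to constant complexes of injectives *)

Section ConstantComplexes.
Variable R : comNzRingType.

(** An injective module with a differential, seen as the complex that is equal
    to it in all degrees. *)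
Record inj_dmod := InjDmod {
  dm_mod :> lmodType R;
  dm_df : {linear dm_mod -> dm_mod};
  dm_dfdf : forall x, dm_df (dm_df x) = 0;
  dm_inj : injective_mod dm_mod
}.

(** Shifting a complex changes the sign of its differential.  A map from a
    shifted complex, or from the first component of a cone, is a map to the
    constant complex with the opposite differential; this replaces the signs
    (-1)^n. *)
Program Definition dm_neg (E : inj_dmod) : inj_dmod :=
  @InjDmod E (\- dm_df E) _ (@dm_inj E).
Next Obligation. by move=> E x /=; rewrite linearN dm_dfdf !oppr0. Qed.

Record emap (X : bcomplex R) (E : inj_dmod) := Emap {
  em :> forall n, {linear X n -> E};
  em_df : forall n (x : X n), em (n + 1) (df X n x) = dm_df E (em n x)
}.

Record dmor (E E' : inj_dmod) := Dmor {
  dmor_fun :> {linear E -> E'};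
  dmor_df : forall x, dmor_fun (dm_df E x) = dm_df E' (dmor_fun x)
}.

Section Homotopy.
Variables (X : bcomplex R) (E : inj_dmod).
Implicit Types a b : emap X E.

Definition homotopic a b := exists h : forall n, {linear X n -> E},
  forall n (x : X n),
    a n x = b n x + (dm_df E (h n x) + h (n + 1) (df X n x)).

Program Definition em_zero : emap X E := @Emap X E (fun=> \0) _.
Next Obligation. by move=> n x /=; rewrite linear0. Qed.

Program Definition em_lin (c : R) a b : emap X E :=
  @Emap X E (fun n => c \*: a n \+ b n) _.
Next Obligation. by move=> c a b n x /=; rewrite !em_df linearP. Qed.

Lemma htp_ext a b : (forall n x, a n x = b n x) -> homotopic a b.
Proof.
by move=> ab; exists (fun=> \0) => n x; rewrite ab /= linear0 !addr0.
Qed.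

Lemma htp_refl a : homotopic a a. Proof. exact: htp_ext. Qed.

Lemma htp_sym a b : homotopic a b -> homotopic b a.
Proof.
move=> [h hh]; exists (fun n => \- h n) => n x.
by rewrite hh /= linearN -opprD addrK.
Qed.

Lemma htp_trans b a c : homotopic a b -> homotopic b c -> homotopic a c.
Proof.
move=> [h hh] [k kk]; exists (fun n => k n \+ h n) => n x.
by rewrite hh kk /= linearD -addrA; congr (_ + _); rewrite addrACA.
Qed.

Lemma htp_lin c a a' b b' :
  homotopic a a' -> homotopic b b' -> homotopic (em_lin c a b) (em_lin c a' b').
Proof.
move=> [h hh] [k kk]; exists (fun n => c \*: h n \+ k n) => n x.
by rewrite /= hh kk linearP !scalerDr addrACA; congr (_ + _); rewrite addrACA.
Qed.

End Homotopy.

Program Definition em_pull (X Y : bcomplex R) E (f : chain_map X Y)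
    (a : emap Y E) : emap X E :=
  @Emap X E (fun n => a n \o f n) _.
Next Obligation. by move=> X Y E f a n x /=; rewrite cm_df em_df. Qed.

Program Definition em_push X (E E' : inj_dmod) (t : dmor E E') (a : emap X E) :
    emap X E' :=
  @Emap X E' (fun n => t \o a n) _.
Next Obligation. by move=> X E E' t a n x /=; rewrite em_df dmor_df. Qed.

Lemma htp_pull (X Y : bcomplex R) E (f : chain_map X Y) (a b : emap Y E) :
  homotopic a b -> homotopic (em_pull f a) (em_pull f b).
Proof.
by move=> [h hh]; exists (fun n => h n \o f n) => n x; rewrite /= hh cm_df.
Qed.

Lemma htp_push X (E E' : inj_dmod) (t : dmor E E') (a b : emap X E) :
  homotopic a b -> homotopic (em_push t a) (em_push t b).
Proof.
move=> [h hh]; exists (fun n => t \o h n) => n x.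
by rewrite /= hh !linearD dmor_df.
Qed.

(** In degree n+1, cH is free up to what ghosts do not see: for a map phi on
    X^(n+1) that vanishes on the coboundaries and sends cocycles to
    coboundaries, c phi = c (d k) on the cocycles, for some k that vanishes on
    the coboundaries of X.  If X is exact in degree n+1, this holds with
    k = 0. *)
Definition splits (c : R) (X : bcomplex R) (n : int) :=
  forall (E : inj_dmod) (phi : {linear X (n + 1) -> E}),
    (forall y, phi (df X n y) = 0) ->
    (forall z, df X (n + 1) z = 0 -> exists y, phi z = dm_df E y) ->
    exists k : {linear X (n + 1) -> E}, (forall y, k (df X n y) = 0) /\
      forall z, df X (n + 1) z = 0 -> c *: phi z = c *: dm_df E (k z).

(** The homotopy h is built by increasing degrees, a finite process since X is
    bounded.  If s f = d h + h d below degree n+1, then phi = s f - d h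
    vanishes on the coboundaries of degree n+1.  Adding k to h in
    degree n+1 makes c phi vanish on the cocycles, hence extend
    along the differential by injectivity; the price is a factor c.  The
    exponent N is the number of degrees, and does not depend on f. *)
Lemma null_homotopy (X : bcomplex R) (c : R) : (forall n, splits c X n) ->
  exists N : nat, forall (E : inj_dmod) (f : emap X E),
    (forall n z, df X n z = 0 -> exists y, f n z = dm_df E y) ->
    homotopic (em_lin (c ^+ N) f (em_zero X E)) (em_zero X E).
Proof.
move=> spl; have [a [b X0]] := cx_bounded X.
exists `|b - a|.+1%N => E f fb.
suff step m : exists h : forall n, {linear X n -> E}, forall k, k < a + m%:Z ->
    forall x : X k, c ^+ m *: f k x = dm_df E (h k x) + h (k + 1) (df X k x).
  have [h hh] := step `|b - a|.+1%N; exists h => n x /=; rewrite addr0 add0r.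
  have [/hh -> //|nb] := ltrP n (a + `|b - a|.+1%:Z).
  rewrite (X0 n _ x) ?linear0 ?scaler0 ?addr0 //.
  apply/orP; right; move: nb; lia.
elim: m => [|m [h hh]].
  exists (fun=> \0) => k ka x; rewrite addr0 in ka.
  by rewrite (X0 k _ x) ?ka // !linear0 addr0.
have [n nE] : exists n, n = a + m%:Z - 1 by eexists.
pose phi : {linear X (n + 1) -> E} :=
  (c ^+ m \*: f (n + 1)) \- (dm_df E \o h (n + 1)).
have nm : n < a + m%:Z by lia.
have [y|z dz|k [kB kZ]] := spl n E phi.
- rewrite /= em_df -linearZ /= hh // linearD dm_dfdf add0r subrr //.
- have [y fy] := fb _ _ dz; exists (c ^+ m *: y - h (n + 1) z).
  by rewrite /= fy linearB linearZ.
(* h is corrected by k in degree n + 1, replaced by l in the next degree, and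
   only multiplied by c below *)
pose h1 : forall j, {linear X j -> E} := fun j => c \*: h j.
pose h2 := dfwith h1 ((h1 (n + 1) \+ (c \*: k)) : {linear X (n + 1) -> E}).
pose psi : {linear X (n + 1) -> E} :=
  (c ^+ m.+1 \*: f (n + 1)) \- (dm_df E \o h2 (n + 1)).
have [z dz|l hl] := @dm_inj E _ _ (df X (n + 1)) psi.
  rewrite /psi /= /h2 dfwith_in /= exprS -scalerA -scalerDr.
  rewrite [dm_df E (_ *: _)]linearZ -scalerBr.
  rewrite [dm_df E _]linearD opprD addrA scalerBr.
  by rewrite -[_ *: f _ z - _]/(phi z) kZ // subrr.
have low j : j < n + 1 -> dfwith h2 l j = h1 j.
  by move=> jn; rewrite /h2 !dfwith_out //; apply/eqP; lia.
exists (dfwith h2 l) => j jm x.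
have [jn|jn|jn] := ltgtP j n.
- rewrite !low /=; try lia.
  rewrite exprS -scalerA hh; last by lia.
  by rewrite scalerDr [dm_df E (_ *: _)]linearZ.
- have ? : j = n + 1 by lia.
  subst j; rewrite dfwith_in hl dfwith_out; last by apply/eqP; lia.
  by rewrite /psi /= [RHS]addrC subrK.
- subst j; rewrite low; last by lia.
  rewrite dfwith_out; last by apply/eqP; lia.
  rewrite /h2 dfwith_in /= kB scaler0 addr0.
  by rewrite exprS -scalerA hh // scalerDr [dm_df E (_ *: _)]linearZ.
Qed.

End ConstantComplexes.

(** * Quasi-isomorphisms and cones *)

Section QuasiIso.
Variable R : comNzRingType.
Implicit Types (X Y : bcomplex R) (E : inj_dmod R).

(** The degrees n + 1 are all the degrees; stating things at n + 1 avoids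
    transports along n - 1 + 1 = n. *)
Lemma int_succ_ind (P : int -> Prop) : (forall n, P (n + 1)) -> forall n, P n.
Proof. by move=> h n; rewrite -(subrK 1 n). Qed.

Lemma reindex_pred X E (f : forall n, {linear X (n + 1) -> E}) :
  exists g : forall n, {linear X n -> E}, forall n, g (n + 1) = f n.
Proof.
exists (fun m => eq_rect _ (fun k => {linear X k -> E}) (f (m - 1)) m
          (subrK 1 m)) => n.
have gen k (e : k + 1 = n + 1) :
    eq_rect (k + 1) (fun k => {linear X k -> E}) (f k) (n + 1) e = f n.
  have kn : k = n by apply: (@addIr _ 1).
  subst k.
  by rewrite (eq_irrelevance e erefl).
exact: gen.
Qed.

Lemma htp_subr X E (a b : emap X E) :
  homotopic (em_lin (-1) b a) (em_zero X E) <-> homotopic a b.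
Proof.
split=> [[h hh]|[h hh]]; exists h => n x; have := hh n x; rewrite /= ?add0r.
  by move=> <-; rewrite scaleN1r addrA subrr add0r.
by move=> ->; rewrite scaleN1r addKr.
Qed.

Lemma htp_eq X E (a a' b b' : emap X E) :
  homotopic a b -> (forall n x, a n x = a' n x) ->
  (forall n x, b n x = b' n x) -> homotopic a' b'.
Proof. by move=> [h hh] aa bb; exists h => n x; rewrite -aa -bb hh. Qed.

Definition acyclic X := forall n (z : X (n + 1)),
  df X (n + 1) z = 0 -> exists y, df X n y = z.

Lemma acyclic_null X E (f : emap X E) : acyclic X -> homotopic f (em_zero X E).
Proof.
move=> acX; have [|N hN] := @null_homotopy R X 1.
  move=> n E' phi phiB _; exists \0; split=> // z /acX[y <-].
  by rewrite phiB /= !linear0.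
have fB : forall n (z : X n), df X n z = 0 -> exists y, f n z = dm_df E y.
  by apply: int_succ_ind => n z /acX[y <-]; exists (f n y); exact: em_df.
by apply: htp_eq (hN E f fB) _ _ => n x //=; rewrite expr1n scale1r addr0.
Qed.

(** For a cocycle (x, y) of the cone, x is a cocycle and s x is minus the
    coboundary of y, so x = d x' by injectivity on cohomology.  Then
    y + s x' is a cocycle, which is s x'' + d y' by surjectivity, and
    (x, y) is the differential of (x'' - x', y'). *)
Lemma acyclic_cone X Y (s : chain_map X Y) : quasi_iso s -> acyclic (cone s).
Proof.
move=> qs n [x y] [/= /eqP]; rewrite oppr_eq0 => /eqP dx /eqP.
rewrite addr_eq0 => /eqP sx.
have [|x' xx'] := (qs (n + 1)).1 x dx; first by exists (- y); rewrite linearN.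
have [|x'' [dx'' [y' yy']]] := (qs n).2 (s (n + 1) x' + y).
  by rewrite linearD -cm_df -xx' sx addNr.
exists (x'' - x', y'); congr pair => /=; last first.
  by rewrite linearB addrAC -yy' addrC addKr.
by rewrite linearB dx'' sub0r opprK.
Qed.

(** A null-homotopy of b f is the same as an extension of b to the cone:
    on (x, y) take h x + b y. *)
Lemma cone_extend X Y E (f : chain_map X Y) (b : emap Y E) :
  homotopic (em_pull f b) (em_zero X E) ->
  exists c : emap (cone f) E, forall n y, em_pull (cone_in f) c n y = b n y.
Proof.
move=> [h hh].
pose g n (z : cone f n) : E := h (n + 1) z.1 + b n z.2.
have gl n : linear (@g n).
  by move=> a x y; rewrite /g !linearP scalerDr addrACA.
have gd n (z : cone f n) :
    lin_of (gl (n + 1)) (df (cone f) n z) = dm_df E (lin_of (gl n) z).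
  rewrite /= /g /= !linearD linearN /= em_df addrA; congr (_ + _).
  by have /= -> := hh (n + 1) z.1; rewrite add0r addrC addrK.
exists (Emap gd) => n y.
by rewrite /= /g /= linear0 add0r.
Qed.

(** The difference of a and b extends to the acyclic cone of s. *)
Lemma quasi_iso_pull_inj X Y E (s : chain_map X Y) (a b : emap Y E) :
  quasi_iso s -> homotopic (em_pull s a) (em_pull s b) -> homotopic a b.
Proof.
move=> qs ab; apply/htp_subr.
have [|c hc] := @cone_extend X Y E s (em_lin (-1) b a).
  by apply: htp_eq ((htp_subr _ _).2 ab) _ _.
apply: htp_trans (htp_sym (htp_ext hc)) _.
by apply: htp_eq (htp_pull (cone_in s) (acyclic_null c _)) _ _ => //;
  exact: acyclic_cone.
Qed.

(** The cone being acyclic, the map (x, y) |-> a x on it is null-homotopic.  The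
    restriction of the homotopy to Y is a chain map b, and its
    restriction to X is a homotopy between b s and a. *)
Lemma quasi_iso_pull_surj X Y E (s : chain_map X Y) (a : emap X E) :
  quasi_iso s -> exists b : emap Y E, homotopic (em_pull s b) a.
Proof.
move=> qs.
pose g n (z : cone s n) : E := a (n + 1) z.1.
have gl n : linear (@g n) by move=> c x y; rewrite /g linearP.
have gd n (z : cone s n) : lin_of (gl (n + 1)) (df (cone s) n z) =
    dm_df (dm_neg E) (lin_of (gl n) z).
  by rewrite /= /g /= linearN em_df.
have [h hh] := acyclic_null
  (@Emap R (cone s) (dm_neg E) (fun n => lin_of (gl n)) gd) (acyclic_cone qs).
have bl n : linear (fun y : Y n => h n ((0, y) : cone s n)).
  move=> c x y; rewrite -linearP; congr (h n _); congr pair => /=.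
  by rewrite scaler0 addr0.
have bd n (y : Y n) :
    lin_of (bl (n + 1)) (df Y n y) = dm_df E (lin_of (bl n) y).
  have := hh n (0, y); rewrite /= /g /= linear0 add0r => /esym/eqP.
  rewrite addrC subr_eq0 => /eqP <-; congr (h _ _).
  by rewrite /cone_df /= !linear0 ?oppr0 add0r.
pose p n (x : X (n + 1)) := h n ((x, 0) : cone s n).
have pl n : linear (@p n).
  move=> c x y; rewrite /p -linearP; congr (h n _); congr pair => /=.
  by rewrite scaler0 addr0.
have [q hq] := reindex_pred (fun n => lin_of (pl n)).
exists (@Emap R Y E (fun n => lin_of (bl n)) bd), q.
apply: int_succ_ind => n x; rewrite !hq /= /p.
have := hh n (x, 0); rewrite /= /g /= add0r => ->.
have -> : cone_df s ((x, 0) : cone s n) =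
   ((0, s (n + 1) x) : cone s (n + 1)) - ((df X (n + 1) x, 0) : cone s (n + 1)).
  rewrite /cone_df /= linear0 addr0; congr pair; last by rewrite /= subr0.
  by rewrite /= sub0r.
by rewrite linearB [RHS]addrACA addNr add0r subrK.
Qed.

End QuasiIso.

(** * Pullback along morphisms of the derived category *)

Section Pullback.
Variable R : comNzRingType.
Implicit Types (X Y Z : bcomplex R) (E : inj_dmod R) (c s : R).

Lemma em_lin_zero X E c (a b : emap X E) :
  homotopic a (em_zero X E) -> homotopic b (em_zero X E) ->
  homotopic (em_lin c a b) (em_zero X E).
Proof.
move=> a0 b0; apply: htp_trans (htp_lin c a0 b0) _.
by apply: htp_ext => n x; rewrite /= scaler0 addr0.
Qed.

Definition quasi_iso_lift X Y E (s : chain_map X Y) (hs : quasi_iso s)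
    (a : emap X E) : emap Y E := projT1 (cid (quasi_iso_pull_surj a hs)).

Lemma quasi_iso_liftK X Y E (s : chain_map X Y) (hs : quasi_iso s)
  (a : emap X E) : homotopic (em_pull s (quasi_iso_lift hs a)) a.
Proof. by rewrite /quasi_iso_lift; case: cid. Qed.

(** A formal inverse acts by a chosen solution of the lifting problem, so that
    all the laws below hold up to homotopy only. *)
Fixpoint dexpr_pull E X Y (e : dexpr X Y) : emap Y E -> emap X E :=
  match e with
  | DGen _ _ f => em_pull f
  | DInv _ _ s hs => quasi_iso_lift hs
  | DCmp _ _ _ g f => fun a => dexpr_pull f (dexpr_pull g a)
  | DZero X Y => fun=> em_zero X E
  | DOpp X Y f => fun a => em_lin (-1) (dexpr_pull f a) (em_zero X E)
  | DAdd _ _ f g => fun a => em_lin 1 (dexpr_pull f a) (dexpr_pull g a)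
  end.

Lemma htp_expr_pull E X Y (e : dexpr X Y) (a b : emap Y E) :
  homotopic a b -> homotopic (dexpr_pull e a) (dexpr_pull e b).
Proof.
elim: e a b => {X Y} /=.
- by move=> X Y f a b; exact: htp_pull.
- move=> X Y s hs a b ab; apply: (quasi_iso_pull_inj hs).
  apply: htp_trans (quasi_iso_liftK hs a) _.
  exact: htp_trans ab (htp_sym (quasi_iso_liftK hs b)).
- by move=> X Y Z g ihg f ihf a b /ihg/ihf.
- by move=> *; exact: htp_refl.
- by move=> X Y f ih a b ab; exact: htp_lin (ih _ _ ab) (htp_refl _).
- by move=> X Y f ihf g ihg a b ab; exact: htp_lin (ihf _ _ ab) (ihg _ _ ab).
Qed.

Lemma dexpr_pull_lin E X Y (e : dexpr X Y) c (a b : emap Y E) :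
  homotopic (dexpr_pull e (em_lin c a b))
            (em_lin c (dexpr_pull e a) (dexpr_pull e b)).
Proof.
elim: e a b => {X Y} /=.
- by move=> X Y f a b; exact: htp_ext.
- move=> X Y s hs a b; apply: (quasi_iso_pull_inj hs).
  apply: htp_trans (quasi_iso_liftK hs _) _; apply: htp_sym.
  apply: htp_trans
    (htp_lin c (quasi_iso_liftK hs a) (quasi_iso_liftK hs b)).
  exact: htp_ext.
- move=> X Y Z g ihg f ihf a b.
  exact: htp_trans (htp_expr_pull f (ihg a b)) (ihf _ _).
- by move=> X Y _ _; apply: htp_ext => n x /=; rewrite scaler0 addr0.
- move=> X Y f ih a b.
  apply: htp_trans (htp_lin (-1) (ih a b) (htp_refl _)) _.
  apply: htp_ext => n x /=.
  by rewrite !addr0 scalerDr !scalerA mulrC.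
- move=> X Y f ihf g ihg a b.
  apply: htp_trans (htp_lin 1 (ihf a b) (ihg a b)) _.
  apply: htp_ext => n x /=.
  by rewrite !scale1r scalerDr addrACA.
Qed.

Lemma dexpr_pull_zero E X Y (e : dexpr X Y) :
  homotopic (dexpr_pull e (em_zero Y E)) (em_zero X E).
Proof.
pose z := em_zero Y E.
apply: (@htp_trans _ _ _ (dexpr_pull e (em_lin (-1) z z))).
  by apply: htp_expr_pull; apply: htp_ext => n x /=; rewrite scaler0 addr0.
apply: htp_trans (dexpr_pull_lin _ _ _ _) _.
by apply: htp_ext => n x /=; rewrite scaleN1r addNr.
Qed.

Lemma dexpr_pull_push E E' (t : dmor E E') X Y (e : dexpr X Y) (a : emap Y E) :
  homotopic (dexpr_pull e (em_push t a)) (em_push t (dexpr_pull e a)).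
Proof.
elim: e a => {X Y} /=.
- by move=> X Y f a; exact: htp_ext.
- move=> X Y s hs a; apply: (quasi_iso_pull_inj hs).
  apply: htp_trans (quasi_iso_liftK hs _) _; apply: htp_sym.
  apply: htp_trans (htp_push t (quasi_iso_liftK hs a)).
  exact: htp_ext.
- move=> X Y Z g ihg f ihf a.
  exact: htp_trans (htp_expr_pull f (ihg a)) (ihf _).
- by move=> X Y _; apply: htp_ext => n x /=; rewrite linear0.
- move=> X Y f ih a.
  apply: htp_trans (htp_lin (-1) (ih a) (htp_refl _)) _.
  by apply: htp_ext => n x /=; rewrite linearP linear0.
- move=> X Y f ihf g ihg a.
  apply: htp_trans (htp_lin 1 (ihf a) (ihg a)) _.
  by apply: htp_ext => n x /=; rewrite linearP.
Qed.

Lemma dexpr_pull_dexpr_eq E X Y (e e' : dexpr X Y) : dexpr_eq e e' ->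
  forall a : emap Y E, homotopic (dexpr_pull e a) (dexpr_pull e' a).
Proof.
elim=> {X Y e e'} /=.
- by move=> *; exact: htp_refl.
- by move=> X Y f g _ ih a; exact: htp_sym.
- by move=> X Y f g h _ ih1 _ ih2 a; exact: htp_trans (ih1 a) (ih2 a).
- move=> X Y Z g g' f f' _ ihg _ ihf a.
  exact: htp_trans (htp_expr_pull f (ihg a)) (ihf _).
- by move=> X Y f f' _ ih a; apply: htp_lin (ih a) (htp_refl _).
- by move=> X Y f f' g g' _ ihf _ ihg a; apply: htp_lin (ihf a) (ihg a).
- by move=> *; exact: htp_refl.
- by move=> X Y f a; apply: htp_expr_pull; exact: htp_ext.
- by move=> X Y f a; exact: htp_ext.
- by move=> X Y f g h a; apply: htp_ext => n x /=; rewrite !scale1r addrA.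
- by move=> X Y f g a; apply: htp_ext => n x /=; rewrite !scale1r addrC.
- by move=> X Y f a; apply: htp_ext => n x /=; rewrite scaler0 add0r.
- move=> X Y f a; apply: htp_ext => n x /=.
  by rewrite scale1r scaleN1r addr0 addNr.
- by move=> X Y Z g1 g2 f a; exact: dexpr_pull_lin.
- by move=> *; exact: htp_refl.
- by move=> X Y f g fg a; apply: htp_ext => n x /=; rewrite fg.
- by move=> *; exact: htp_ext.
- by move=> X Y f g a; apply: htp_ext => n x /=; rewrite linearD scale1r.
- move=> X Y s hs a.
  by apply: htp_trans (quasi_iso_liftK hs a) _; exact: htp_ext.
- move=> X Y s hs a; apply: (quasi_iso_pull_inj hs).
  by apply: htp_trans (quasi_iso_liftK hs _) _; exact: htp_ext.
Qed.

Definition dpull E (X Y : Db_cat R) (f : hom X Y) : emap Y E -> emap X E :=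
  dexpr_pull (drepr f).

Lemma htp_dpull E (X Y : Db_cat R) (f : hom X Y) (a b : emap Y E) :
  homotopic a b -> homotopic (dpull f a) (dpull f b).
Proof. exact: htp_expr_pull. Qed.

Lemma dpull_zero E (X Y : Db_cat R) (f : hom X Y) :
  homotopic (dpull f (em_zero Y E)) (em_zero X E).
Proof. exact: dexpr_pull_zero. Qed.

Lemma dpull_dpi E X Y (e : dexpr X Y) (a : emap Y E) :
  homotopic (@dpull E X Y (dpi e) a) (dexpr_pull e a).
Proof. by apply: dexpr_pull_dexpr_eq; exact: drepr_dpi. Qed.

Lemma dpullM E (X Y Z : Db_cat R) (g : hom Y Z) (f : hom X Y) (a : emap Z E) :
  homotopic (dpull (g \oc f) a) (dpull f (dpull g a)).
Proof. exact: dpull_dpi. Qed.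

Lemma dpullD E (X Y : Db_cat R) (f g : hom X Y) (a : emap Y E) :
  homotopic (dpull (f \+c g) a) (em_lin 1 (dpull f a) (dpull g a)).
Proof. exact: dpull_dpi. Qed.

Lemma dpull0 E (X Y : Db_cat R) (a : emap Y E) :
  homotopic (dpull (hzero X Y) a) (em_zero X E).
Proof. exact: dpull_dpi. Qed.

Lemma dpull1 E (X : Db_cat R) (a : emap X E) : homotopic (dpull (idm X) a) a.
Proof. by apply: htp_trans (dpull_dpi _ _) _; exact: htp_ext. Qed.

Lemma dpull_cancel E (X Y : Db_cat R) (f : hom X Y) (g : hom Y X)
  (a : emap X E) : g \oc f = idm X -> homotopic (dpull f (dpull g a)) a.
Proof.
move=> gf; apply: htp_trans (htp_sym (dpullM _ _ _)) _.
by rewrite gf; exact: dpull1.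
Qed.

(** Exactness of [Z, E] -> [Y, E] -> [X, E].  It is invariant under isomorphisms
    of triangles, and is [cone_extend] for the cone of a chain map. *)
Lemma dist_exact E (X Y Z : Db_cat R) (u : hom X Y) (v : hom Y Z)
    (w : hom Z (Db_shift R X)) (b : emap Y E) :
  Db_dist u v w -> homotopic (dpull u b) (em_zero X E) ->
  exists c : emap Z E, homotopic (dpull v c) b.
Proof.
move=> [A [B [f [i [j [k]]]]]].
move=> [[[i' [i'i ii']] [j' [j'j jj']] _] [ju kv _]] ub.
pose b' := dpull j' b.
have [|c hc] := @cone_extend R A B E f b'.
  apply: htp_trans (htp_sym (dpull_cancel _ ii')) _.
  apply: htp_trans (dpull_zero E i'); apply: htp_dpull.
  apply: htp_trans (htp_dpull _ (htp_sym (dpull_dpi (DGen f) b'))) _.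
  apply: htp_trans (htp_sym (dpullM _ _ _)) _.
  rewrite -[dpi _]/(Db_of f) -ju.
  apply: htp_trans (dpullM _ _ _) _; apply: htp_trans (htp_dpull _ _) ub.
  exact: dpull_cancel.
exists (dpull k c).
apply: htp_trans (htp_sym (dpullM _ _ _)) _; rewrite kv.
apply: htp_trans (dpullM _ _ _) _.
apply: htp_trans (dpull_cancel b j'j); apply: htp_dpull.
by apply: htp_trans (dpull_dpi _ _) _; exact: htp_ext.
Qed.

End Pullback.

(** * The ghost lemma *)

Section Ghosts.
Variable R : comNzRingType.
Implicit Types (E : inj_dmod R) (c s : R).

Definition ghost E E' (t : dmor E E') :=
  forall x, dm_df E x = 0 -> exists y, t x = dm_df E' y.

(** Composites of m ghosts, preceded by an arbitrary map; the latter makes the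
    condition decreasing in m. *)
Fixpoint ghostly (m : nat) E E' (t : dmor E E') : Prop :=
  match m with
  | 0 => True
  | m'.+1 => exists (E1 : inj_dmod R) (t1 : dmor E E1) (g : dmor E1 E'),
      [/\ ghost g, ghostly m' t1 & forall x, t x = g (t1 x)]
  end.

Lemma ghostly_weaken m k E E' (t : dmor E E') :
  (k <= m)%N -> ghostly m t -> ghostly k t.
Proof.
elim: m k E' t => [|m ih] [|k] E' t //= km [E1 [t1 [g [gg ht tg]]]].
by exists E1, t1, g; split=> //; exact: ih ht.
Qed.

Program Definition dmor_neg E E' (t : dmor E E') :
    dmor (dm_neg E) (dm_neg E') :=
  @Dmor R (dm_neg E) (dm_neg E') t _.
Next Obligation. by move=> E E' t x; rewrite /= linearN dmor_df. Qed.

Lemma ghostly_neg m E E' (t : dmor E E') :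
  ghostly m t -> ghostly m (dmor_neg t).
Proof.
elim: m E' t => [|m ih] E' t //= [E1 [t1 [g [gg ht tg]]]].
exists (dm_neg E1), (dmor_neg t1), (dmor_neg g); split=> //; last exact: ih.
move=> x /= /eqP; rewrite oppr_eq0 => /eqP /gg[y gy].
by exists (- y); rewrite linearN opprK.
Qed.

Definition null_push s E E' (t : dmor E E') (X : bcomplex R) (a : emap X E) :=
  homotopic (em_lin s (em_push t a) (em_zero X E')) (em_zero X E').

Definition kills s (m : nat) (X : bcomplex R) :=
  forall E E' (t : dmor E E'), ghostly m t ->
    forall a : emap X E, null_push s t a.

Lemma dpull_scale E (X Y : Db_cat R) (f : hom X Y) c (a : emap Y E) :
  homotopic (dpull f (em_lin c a (em_zero Y E)))
            (em_lin c (dpull f a) (em_zero X E)).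
Proof.
apply: htp_trans (dexpr_pull_lin _ _ _ _) _.
by apply: htp_lin (htp_refl _) _; exact: dpull_zero.
Qed.

Lemma dpull_killed s m (X Y : Db_cat R) (f : hom X Y) E E' (t : dmor E E')
    (a : emap Y E) :
  kills s m Y -> ghostly m t -> null_push s t (dpull f a : emap X E).
Proof.
move=> kY gt.
apply: htp_trans
  (htp_lin s (htp_sym (dexpr_pull_push _ _ _)) (htp_refl _)) _.
apply: htp_trans (htp_sym (dpull_scale _ _ _)) _.
by apply: htp_trans (dpull_zero _ f); apply: htp_dpull; exact: kY.
Qed.

Lemma htp_null_push s E E' (t : dmor E E') (X : bcomplex R) (a b : emap X E) :
  homotopic a b -> null_push s t b -> null_push s t a.
Proof.
by move=> ab; apply: htp_trans; apply: htp_lin (htp_push t ab) (htp_refl _).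
Qed.

Lemma kills_retract s m (X Y : Db_cat R) (i : hom X Y) (p : hom Y X) :
  p \oc i = idm X -> kills s m Y -> kills s m X.
Proof.
move=> pi kY E E' t gt a.
apply: (htp_null_push (htp_sym (dpull_cancel a pi))).
exact: (dpull_killed i (dpull p a) kY gt).
Qed.

Lemma kills_iso s m (X Y : Db_cat R) :
  isomorphic X Y -> kills s m X <-> kills s m Y.
Proof. by move=> [f [g [gf fg]]]; split; apply: kills_retract; eassumption. Qed.

Lemma kills_biproduct s m (X Y S : Db_cat R) :
  is_biproduct X Y S -> kills s m X -> kills s m Y -> kills s m S.
Proof.
move=> [i1 [i2 [p1 [p2 [_ _ _ _ e]]]]] kX kY E E' t gt a.
pose a1 := dpull p1 (dpull i1 a); pose a2 := dpull p2 (dpull i2 a).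
apply: (htp_null_push (b := em_lin 1 a1 a2)).
  apply: htp_trans (htp_sym (dpull1 a)) _; rewrite -e.
  apply: htp_trans (dpullD _ _ _) _.
  by apply: htp_lin; exact: dpullM.
apply: htp_trans (em_lin_zero 1 (dpull_killed p1 (dpull i1 a) kX gt)
                    (dpull_killed p2 (dpull i2 a) kY gt)).
by apply: htp_ext => n x /=; rewrite !addr0 linearP scalerDr !scale1r.
Qed.

Lemma kills_zero s m (Z : Db_cat R) : idm Z = hzero Z Z -> kills s m Z.
Proof.
move=> Z0 E E' t gt a; apply: (htp_null_push (b := em_zero Z E)).
  apply: htp_trans (htp_sym (dpull1 a)) _.
  by rewrite Z0; exact: dpull0.
by apply: htp_ext => n x /=; rewrite linear0 scaler0 addr0.
Qed.

(** A map from X[1] to E is a map from X to E with the opposite differential, up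
    to the numbering of the degrees. *)
Lemma kills_shift s m (X : bcomplex R) : kills s m (cx_shift X) <-> kills s m X.
Proof.
split=> kX E E' t gt a.
  pose b n := a (n + 1).
  have bd n (x : cx_shift X n) :
      b (n + 1) (df (cx_shift X) n x) = dm_df (dm_neg E) (b n x).
    by rewrite /b /= linearN em_df.
  have [h hh] :=
    kX _ _ _ (ghostly_neg gt) (@Emap R (cx_shift X) (dm_neg E) b bd).
  have [q hq] := reindex_pred (fun n => (\- h n : {linear X (n + 1) -> E'})).
  exists q; apply: int_succ_ind => n x; rewrite !hq.
  by have /= -> := hh n x; rewrite !linearN.
have [g hg] := reindex_pred a.
have gd n (x : X n) : g (n + 1) (df X n x) = dm_df (dm_neg E) (g n x).
  elim/int_succ_ind: n x => n x; rewrite !hg /=.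
  have /= := em_df a (x : cx_shift X n).
  by rewrite linearN => <-; rewrite opprK.
have [h hh] := kX _ _ _ (ghostly_neg gt) (@Emap R X (dm_neg E) g gd).
exists (fun n => (\- h (n + 1) : {linear X (n + 1) -> E'})) => n x.
have /= := hh (n + 1) x; rewrite hg => ->.
by rewrite !linearN opprK.
Qed.

(** Let t = g t1 with g the last ghost.  The class s t1 a vanishes on X, hence
    comes from Z by exactness, where s' g kills it. *)
Lemma kills_extension s s' m (X Y Z : Db_cat R) (u : hom X Y) (v : hom Y Z)
    (w : hom Z (Db_shift R X)) : Db_dist u v w ->
  kills s m X -> kills s' 1 Z -> kills (s' * s) m.+1 Y.
Proof.
move=> uvw kX kZ E E' t /= [E1 [t1 [g [gg gt1 tg]]]] a.
have [|c hc] := dist_exact (b := em_lin s (em_push t1 a) (em_zero Y E1)) uvw.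
  apply: htp_trans (dpull_scale _ _ _) _.
  apply: htp_trans
    (htp_lin s (dexpr_pull_push _ _ _) (htp_refl _)) _.
  exact: kX.
have gg1 : ghostly 1 g.
  by exists E1, (@Dmor R E1 E1 idfun (fun=> erefl)), g.
have := htp_null_push (htp_sym hc) (dpull_killed v c kZ gg1).
apply: htp_trans; apply: htp_ext => n x /=.
by rewrite !addr0 tg linearZ scalerA.
Qed.

End Ghosts.

(** * Complexes in the image of a triangulated functor *)

Section TriangulatedFunctor.
Variables (R : comNzRingType) (T : tri_data) (F : tri_functor T (Db R)).

Lemma fmor_zero (X Y : T) : fmor F (hzero X Y) = hzero (F X) (F Y).
Proof.
set z := fmor F _.
have zz : z \+c z = z by rewrite -fmorD hadd0f.
by rewrite -(haddNf z) -{3}zz haddA haddNf hadd0f.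
Qed.

Lemma iso_fob (X Y : T) : isomorphic X Y -> @isomorphic (Db R) (F X) (F Y).
Proof.
move=> [f [g [gf fg]]]; exists (fmor F f), (fmor F g).
by rewrite -!fmorM gf fg !fmor1.
Qed.

Lemma biproduct_fob (X Y S : T) :
  is_biproduct X Y S -> @is_biproduct (Db R) (F X) (F Y) (F S).
Proof.
move=> [i1 [i2 [p1 [p2 [e1 e2 e3 e4 e5]]]]].
exists (fmor F i1), (fmor F i2), (fmor F p1), (fmor F p2).
by rewrite -!fmorM -fmorD e1 e2 e3 e4 e5 !fmor1 !fmor_zero.
Qed.

Lemma kills_iter_shift (s : R) m k (X : T) :
  kills s m (F (iter k (@Defs.shift T) X)) <-> kills s m (F X).
Proof.
elim: k => [|k ih] //=.
apply: iff_trans ih; apply: iff_trans (kills_shift s m _).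
apply: (@kills_iso R s m); exists (tf_xi F _).
exact: (tf_xi_iso F (iter k (@Defs.shift T) X)).
Qed.

Lemma kills_sum_of_shifts (s : R) (G X : T) :
  kills s 1 (F G) -> sum_of_shifts G X -> kills s 1 (F X).
Proof.
move=> kG; elim=> {X} [S S0|i X Y S XG _ kY XYS].
  apply: kills_zero; rewrite -fmor_zero -fmor1; congr (fmor F _).
  exact: (S0 S).1.
apply: kills_biproduct (biproduct_fob XYS) _ kY.
case: i XG => k /iso_fob /(kills_iso s 1) => [<-|].
  exact/kills_iter_shift.
by move=> e; apply/(kills_iter_shift _ _ k.+1)/e.
Qed.

(** The class [G]_k needs k cones on sums of shifts of G, so k+1 ghosts and k+1
    factors s. *)
Lemma kills_ext_of_shifts (s : R) (G : T) k (X : T) :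
  kills s 1 (F G) -> ext_of_shifts G k X -> kills (s ^+ k.+1) k.+1 (F X).
Proof.
move=> kG; elim: k X => [|k ih] X /=; first exact: kills_sum_of_shifts.
move=> [X' [X0 [u [v [w [uvw sX0 eX']]]]]].
rewrite exprS; apply: kills_extension (tf_dist F uvw) (ih _ eX') _.
exact: kills_sum_of_shifts sX0.
Qed.

Lemma kills_generated (s : R) (G : T) k (X : T) :
  kills s 1 (F G) -> generated G k X -> kills (s ^+ k.+1) k.+1 (F X).
Proof.
move=> kG [X' [S [XX'S eS]]].
have [i1 [_ [p1 [_ [e _ _ _ _]]]]] := biproduct_fob XX'S.
exact: kills_retract e (kills_ext_of_shifts kG eS).
Qed.

End TriangulatedFunctor.

(** * Finitely generated modules over a Noetherian ring *)

Section Spans.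
Variables (R : comNzRingType) (V : lmodType R).

(** Elements of the submodule generated by B and gs, by recursion on gs: all the
    proofs below add generators one at a time. *)
Fixpoint span_mod (B : set V) (gs : seq V) (v : V) : Prop :=
  if gs is g :: gs' then exists c, span_mod B gs' (v - c *: g) else B v.

Lemma span_mod_closed (B : submodule V) gs :
  submod_closed [pred v | v \in [set v | span_mod (sm_set B) gs v]].
Proof.
have [B0 BP] := sm_closed B.
elim: gs => [|g gs [ih0 ihP]] /=; split.
- by move: B0; rewrite !inE.
- by move=> a x y; have := BP a x y; rewrite !inE.
- by move: ih0; rewrite !inE => ih0; exists 0; rewrite scale0r subr0.
- move=> a x y; rewrite !inE => -[c hc] [e he]; exists (a * c + e).
  have := ihP a _ _ (mem_set hc) (mem_set he); rewrite inE.
  by rewrite scalerBr scalerDl scalerA opprD addrACA.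
Qed.

Definition span_submod B gs := Submodule (span_mod_closed B gs).

Lemma span_mod_cat (B : set V) (I : Type) (r : seq I) (c : I -> R)
    (w : I -> V) gs v :
  span_mod B gs (v - \sum_(i <- r) c i *: w i) -> span_mod B (map w r ++ gs) v.
Proof.
elim: r v => [|i r ih] v; first by rewrite big_nil subr0.
by rewrite big_cons opprD addrA => /ih; exists (c i).
Qed.

Lemma fin_gen_span : fin_gen V -> exists gs, forall v, span_mod [set 0] gs v.
Proof.
move=> [k [g hg]]; exists (map g (enum 'I_k)) => v; have [c ->] := hg v.
rewrite -[map _ _]cats0; apply: (span_mod_cat (c := c)).
by rewrite big_enum /= subrr.
Qed.

(** By induction on the generators of V: the coefficients of the first generator
    g in the elements of S form an ideal, generated by the coefficients e_i of
    finitely many w_i in S, and subtracting a combination of the w_i leaves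
    an element of S in the span of the other generators. *)
Lemma noetherian_submod (S : submodule V) gs : noetherian R ->
  (forall v, sm_set S v -> span_mod [set 0] gs v) ->
  exists ss, (forall x, x \in ss -> sm_set S x) /\
             forall v, sm_set S v -> span_mod [set 0] ss v.
Proof.
move=> noeth; elim: gs S => [|g gs ih] S hS; first by exists [::].
pose O := kernel (idfun : {linear V -> V}).
pose L := span_submod O gs.
have OE : sm_set O = [set 0] by [].
pose I : set R := [set c | exists w, sm_set S w /\ sm_set L (w - c *: g)].
have idI : ideal I.
  split.
  - by exists 0; rewrite scale0r subr0; split; exact: submod0.
  - move=> x y [u [Su Lu]] [w [Sw Lw]]; exists (1 *: u + w).
    split; first exact: submodP.
    have := submodP 1 Lu Lw.
    by rewrite !scale1r scalerDl opprD addrACA.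
  - move=> a x [u [Su Lu]]; exists (a *: u); split; first exact: submodZ.
    by rewrite -scalerA -scalerBr; exact: submodZ.
have [k [e [Ie eI]]] := noeth I idI.
pose w i := projT1 (cid (Ie i)).
have [Sw Lw] : (forall i, sm_set S (w i)) /\
    forall i, sm_set L (w i - e i *: g).
  by split=> i; rewrite /w; case: cid => ? [].
have S'c : submod_closed [pred v | v \in [set v | sm_set S v /\ sm_set L v]].
  split; first by rewrite inE; split; exact: submod0.
  move=> a x y; rewrite !inE => -[Sx Lx] [Sy Ly].
  by split; exact: submodP.
have [|ss [Sss spss]] := ih (Submodule S'c); first by move=> v [_].
exists (map w (enum 'I_k) ++ ss); split.
  move=> x; rewrite mem_cat => /orP[/mapP[i _ ->] //|/Sss[]//].
move=> v Sv; have [c Lc] := hS _ Sv.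
have Ic : I c by exists v.
have [b bE] := eI _ Ic.
apply: (span_mod_cat (c := b)); rewrite big_enum /=; apply: spss; split.
  by apply: submodB => //; exact: submod_sum.
have -> : v - \sum_i b i *: w i =
    (v - c *: g) - \sum_i b i *: (w i - e i *: g).
  have -> : \sum_i b i *: (w i - e i *: g) = \sum_i b i *: w i - c *: g.
    rewrite bE scaler_suml -sumrB; apply: eq_bigr => i _.
    by rewrite scalerBr scalerA.
  by rewrite opprB addrA subrK.
by apply: submodB => //; exact: submod_sum.
Qed.

(** W + R g is the direct sum of W and of a free module on g, on which the map
    0 + (g |-> e) is defined; it extends to V by injectivity. *)
Lemma injective_prescribe (E : lmodType R) (W : submodule V) g e :
  injective_mod E -> (forall c : R, sm_set W (c *: g) -> c = 0) ->
  exists l : {linear V -> E}, (forall w, sm_set W w -> l w = 0) /\ l g = e.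
Proof.
move=> injE Wg.
pose d (p : (sub_mod W * R^o)%type) : V := sub_val p.1 + (p.2 : R) *: g.
pose f (p : (sub_mod W * R^o)%type) : E := (p.2 : R) *: e.
have dl : linear d.
  by move=> a x y; rewrite /d /= scalerDr scalerDl scalerA addrACA.
have fl : linear f by move=> a x y; rewrite /f /= scalerDl scalerA.
have inW w : w \in sm_pred W -> sm_set W w by rewrite sm_predE inE.
have [[w c] /= /eqP|l hl] := injE _ _ (lin_of dl) (lin_of fl).
  rewrite /d addrC addr_eq0 /f /= => /eqP cg.
  rewrite (Wg c) ?scale0r // cg -scaleN1r; apply: submodZ; apply: inW.
  exact: sub_valP.
exists l; split=> [w Ww|].
  have wP : w \in sm_pred W by rewrite sm_predE inE.
  by have := hl (SubMod wP, 0); rewrite /= /d /f /= !scale0r addr0.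
have := hl (0, 1); rewrite /= /d /f /= !scale1r.
by rewrite add0r.
Qed.

End Spans.

(** * Uniform splitting over a Noetherian domain *)

Section Splitting.
Variable R : idomainType.

(** By induction on gs.  A generator g which is torsion modulo the previous ones
    only multiplies c.  Otherwise g is free modulo the previous ones, and k can
    be changed at g alone, so as to take the value y there, where d y = phi g.
    The dichotomy concerns B and gs only, which is why c does not depend on E
    and phi. *)
Lemma split_span (V : lmodType R) (B : submodule V) gs :
  exists2 c : R, c != 0 &
    forall (E : inj_dmod R) (phi : {linear V -> E}),
      (forall b, sm_set B b -> phi b = 0) ->
      (forall g, g \in gs -> exists y, phi g = dm_df E y) ->
      exists k : {linear V -> E}, (forall b, sm_set B b -> k b = 0) /\
        forall v, span_mod (sm_set B) gs v -> c *: phi v = c *: dm_df E (k v).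
Proof.
elim: gs => [|g gs [c c0 hc]].
  exists 1; first exact: oner_neq0.
  move=> E phi phiB _; exists \0; split=> // v /= Bv.
  by rewrite phiB //= !linear0.
pose W := span_submod B gs.
have [[c' [c'0 Wg]]|none] :=
  pselect (exists c' : R, c' != 0 /\ sm_set W (c' *: g)).
  exists (c * c'); first by rewrite mulf_neq0.
  move=> E phi phiB phigs; have [|k [kB kE]] := hc E phi phiB.
    by move=> h hgs; apply: phigs; rewrite inE hgs orbT.
  exists k; split=> // v /= [a ha].
  have /kE : span_mod (sm_set B) gs (c' *: v).
    have := submodP a Wg (submodZ c' (ha : sm_set W _)).
    by rewrite scalerBr !scalerA mulrC addrC subrK.
  by rewrite [phi _]linearZ [k _]linearZ [dm_df E _]linearZ !scalerA.
exists c => // E phi phiB phigs; have [|k [kB kE]] := hc E phi phiB.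
  by move=> h hgs; apply: phigs; rewrite inE hgs orbT.
have [y gy] := phigs g (mem_head _ _).
have [e We|l [lW lg]] :=
    injective_prescribe (y - k g) (@dm_inj R E) (W := W) (g := g).
  by apply: contrapT => /eqP e0; apply: none; exists e.
have BW b : sm_set B b -> sm_set W b.
  rewrite /W /=; elim: (gs) b => [//|h s ih] b Bb; exists 0.
  by rewrite scale0r subr0; exact: ih.
exists (k \+ l); split=> [b Bb|v /= [a ha]].
  by rewrite /= kB // lW ?addr0 //; exact: BW.
have vE : v = (v - a *: g) + a *: g by rewrite subrK.
move: (v - a *: g) ha vE => w ha ->.
rewrite [phi (_ + _)]linearD [k (_ + _)]linearD [l (_ + _)]linearD /= (lW _ ha).
rewrite add0r -addrA [phi (_ *: _)]linearZ.
have -> : k (a *: g) + l (a *: g) = a *: y.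
  by rewrite !linearZ -scalerDr lg addrC subrK.
rewrite [dm_df E (_ + _)]linearD [dm_df E (_ *: _)]linearZ !scalerDr kE //.
by rewrite gy.
Qed.

Lemma splits_scale (X : bcomplex R) n c e : splits c X n -> splits (e * c) X n.
Proof.
move=> hc E phi h1 h2; have [k [kB kE]] := hc E phi h1 h2.
by exists k; split=> // z /kE; rewrite -!scalerA => ->.
Qed.

Lemma splits_degree (X : bcomplex R) n : noetherian R ->
  exists2 c : R, c != 0 & splits c X n.
Proof.
move=> noeth.
have [gs hgs] := fin_gen_span (cx_fg X (n + 1)).
pose Z := kernel (df X (n + 1)).
have [|ss [Zss Zsp]] := @noetherian_submod R _ Z gs noeth; first by move=> v _.
have [c c0 hc] := split_span (lin_range (df X n)) ss.
exists c => // E phi phiB phiZ; have [_ [y <-]|g|k [kB kE]] := hc E phi.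
- exact: phiB.
- by move=> /Zss; exact: phiZ.
exists k; split=> [y|z dz]; first by apply: kB; exists y.
apply: kE; have := Zsp z dz.
elim: (ss) z {dz} => [|g s ih] z /=.
  by move=> ->; exists 0; rewrite linear0.
by move=> [b /ih hb]; exists b.
Qed.

Lemma splits_bounded (X : bcomplex R) : noetherian R ->
  exists2 c : R, c != 0 & forall n, splits c X n.
Proof.
move=> noeth; have [a [b X0]] := cx_bounded X.
have triv c n : (n + 1 < a) || (b < n + 1) -> splits c X n.
  move=> hn E phi _ _; exists \0; split=> // z _.
  by rewrite (X0 _ hn z) /= !linear0.
suff step m : exists2 c : R, c != 0 &
    forall n, n + 1 < a + m%:Z -> splits c X n.
  have [c c0 hc] := step `|b - a|.+1%N; exists c => // n.
  have [/hc //|nb] := ltrP (n + 1) (a + `|b - a|.+1%:Z).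
  by apply: triv; lia.
elim: m => [|m [c c0 hc]].
  by exists 1; [exact: oner_neq0 | move=> n na; apply: triv; lia].
have [e e0 he] := splits_degree X (a + m%:Z - 1) noeth.
exists (e * c); first by rewrite mulf_neq0.
move=> n nm; have [/hc|nm'] := ltrP (n + 1) (a + m%:Z).
  exact: splits_scale.
have -> : n = a + m%:Z - 1 by lia.
by rewrite mulrC; exact: splits_scale.
Qed.

(** A ghost turns any map into one that sends cocycles to coboundaries. *)
Lemma kills_ghost (X : bcomplex R) : noetherian R ->
  exists2 s : R, s != 0 & kills s 1 X.
Proof.
move=> noeth; have [c c0 hc] := splits_bounded X noeth.
have [N hN] := null_homotopy hc.
exists (c ^+ N); first by rewrite expf_neq0.
move=> E E' t [E1 [t1 [g [gg _ tg]]]] a; apply: hN => n z dz /=.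
by rewrite tg; apply: gg; rewrite -dmor_df -em_df dz !linear0.
Qed.

End Splitting.

(** * The total complex of an injective resolution *)

Section ProductModule.
Variables (R : comNzRingType) (J : nat -> lmodType R).

Definition mod_prod := forall j, J j.

Lemma mod_prod_ext (x y : mod_prod) : (forall j, x j = y j) -> x = y.
Proof. exact: functional_extensionality_dep. Qed.

HB.instance Definition _ := gen_eqMixin mod_prod.
HB.instance Definition _ := gen_choiceMixin mod_prod.

Let add (x y : mod_prod) : mod_prod := fun j => x j + y j.
Let opp (x : mod_prod) : mod_prod := fun j => - x j.
Let zero : mod_prod := fun=> 0.
Let scale (a : R) (x : mod_prod) : mod_prod := fun j => a *: x j.

Fact mod_prod_addA : associative add.
Proof. by move=> x y z; apply: mod_prod_ext => j; exact: addrA. Qed.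
Fact mod_prod_addC : commutative add.
Proof. by move=> x y; apply: mod_prod_ext => j; exact: addrC. Qed.
Fact mod_prod_add0 : left_id zero add.
Proof. by move=> x; apply: mod_prod_ext => j; exact: add0r. Qed.
Fact mod_prod_addN : left_inverse zero opp add.
Proof. by move=> x; apply: mod_prod_ext => j; exact: addNr. Qed.

HB.instance Definition _ := GRing.isZmodule.Build mod_prod
  mod_prod_addA mod_prod_addC mod_prod_add0 mod_prod_addN.

Fact mod_prod_scaleA a b x : scale a (scale b x) = scale (a * b) x.
Proof. by apply: mod_prod_ext => j; exact: scalerA. Qed.
Fact mod_prod_scale1 : left_id 1 scale.
Proof. by move=> x; apply: mod_prod_ext => j; exact: scale1r. Qed.
Fact mod_prod_scaleDr : right_distributive scale +%R.
Proof. by move=> a x y; apply: mod_prod_ext => j; exact: scalerDr. Qed.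
Fact mod_prod_scaleDl x : {morph scale^~ x : a b / a + b}.
Proof. by move=> a b; apply: mod_prod_ext => j; exact: scalerDl. Qed.

HB.instance Definition _ := GRing.Zmodule_isLmodule.Build R mod_prod
  mod_prod_scaleA mod_prod_scale1 mod_prod_scaleDr mod_prod_scaleDl.

Lemma injective_mod_prod :
  (forall j, injective_mod (J j)) -> injective_mod (mod_prod : lmodType R).
Proof.
move=> injJ A B d f df.
have fl j : linear (fun x => f x j) by move=> a x y; rewrite linearP.
have ex j : exists g : {linear B -> J j}, forall x, g (d x) = f x j.
  by apply: (injJ j A B d (lin_of (fl j))) => x /df /= ->.
pose g j := projT1 (cid (ex j)).
have gE j x : g j (d x) = f x j by rewrite /g; case: cid.
have gl : linear ((fun y j => g j y) : B -> mod_prod).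
  by move=> a x y; apply: mod_prod_ext => j; rewrite linearP.
exists (lin_of gl) => x /=.
by apply: mod_prod_ext => j; exact: gE.
Qed.

End ProductModule.

Section TotalComplex.
Variable R : comNzRingType.
Implicit Type J : inj_sequence R.

Definition total_df J (x : mod_prod J) : mod_prod J :=
  fun j => match j with 0 => 0 | j'.+1 => is_df J j' (x j') end.

Lemma total_df_linear J : linear (@total_df J).
Proof.
move=> a x y; apply: mod_prod_ext => -[|j] /=.
  by rewrite -[RHS]/(a *: (0 : J 0) + 0) scaler0 addr0.
exact: linearP.
Qed.

Lemma total_dfdf J (x : mod_prod J) : total_df (total_df x) = 0.
Proof.
apply: mod_prod_ext => -[|[|j]] //=; first exact: linear0.
by apply/is_exact; exists (x j).
Qed.

(** The product of all the shifts of the complex J: in each degree it is the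
    product of all the J_j. *)
Definition total J : inj_dmod R :=
  @InjDmod R (mod_prod J) (lin_of (@total_df_linear J)) (@total_dfdf J)
    (injective_mod_prod (@is_inj R J)).

Definition tail_fun J (x : mod_prod (inj_tail J)) : mod_prod J :=
  fun j => match j with 0 => 0 | j'.+1 => x j' end.

Lemma tail_fun_linear J : linear (@tail_fun J).
Proof.
move=> a x y; apply: mod_prod_ext => -[|j] //=.
by rewrite -[RHS]/(a *: (0 : J 0) + 0) scaler0 addr0.
Qed.

Lemma tail_fun_df J (x : mod_prod (inj_tail J)) :
  tail_fun (total_df x) = total_df (tail_fun x).
Proof.
apply: mod_prod_ext => -[|[|j]] //=. by rewrite linear0.
Qed.

Definition tail_mor J : dmor (total (inj_tail J)) (total J) :=
  @Dmor R (total (inj_tail J)) (total J) (lin_of (@tail_fun_linear J))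
    (@tail_fun_df J).

(** A cocycle of the truncation has cocycles of positive degree as components,
    which are coboundaries in J by exactness. *)
Lemma ghost_tail_mor J : ghost (tail_mor J).
Proof.
move=> x /= dx.
have ex j : exists y, is_df J j y = x j.
  apply/is_exact; exact: (congr1 (fun z : mod_prod (inj_tail J) => z j.+1) dx).
exists (fun j => projT1 (cid (ex j))).
apply: mod_prod_ext => -[|j] //=.
by case: cid.
Qed.

Fixpoint inj_tails (m : nat) J : inj_sequence R :=
  if m is m'.+1 then inj_tail (inj_tails m' J) else J.

Program Definition dmor_comp (E E' E'' : inj_dmod R) (u : dmor E' E'')
    (t : dmor E E') : dmor E E'' :=
  @Dmor R E E'' (u \o t) _.
Next Obligation. by move=> E E' E'' u t x; rewrite /= !dmor_df. Qed.

Definition dmor_id (E : inj_dmod R) : dmor E E :=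
  @Dmor R E E idfun (fun=> erefl).

(** A composite is split off at its last ghost by [ghostly], whereas truncations
    are added in front; a ghost followed by any map is again a ghost, which
    starts the induction. *)
Lemma ghostly_precomp m (E E' E'' : inj_dmod R) (u : dmor E' E'')
    (g : dmor E E') : ghost g -> ghostly m u -> ghostly m.+1 (dmor_comp u g).
Proof.
move=> gg; elim: m E'' u => [|m ih] E'' u.
  move=> _; exists E, (dmor_id E), (dmor_comp u g); split=> // x /gg[y gy].
  by exists (u y); rewrite /= gy dmor_df.
move=> [E1 [u1 [g' [gg' gu ug]]]].
exists E1, (dmor_comp u1 g), g'; split=> //; first exact: ih.
by move=> x; exact: ug.
Qed.

Fixpoint tails_mor m J : dmor (total (inj_tails m J)) (total J) :=
  match m with
  | 0 => dmor_id (total J)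
  | m'.+1 => dmor_comp (tails_mor m' J) (tail_mor (inj_tails m' J))
  end.

Lemma ghostly_tails_mor m J : ghostly m (tails_mor m J).
Proof.
by elim: m => [|m ih] //; apply: ghostly_precomp ih; exact: ghost_tail_mor.
Qed.

(** The component of h in the factor that holds y_j is a primitive of y_(j+1).
    The component y_0 is lost, since h may involve the factor of J just below
    the truncation. *)
Lemma tails_mor_boundary m J (M : lmodType R)
    (y : {linear M -> mod_prod (inj_tails m J)})
    (h : {linear M -> mod_prod J}) :
  (forall x, tails_mor m J (y x) = total_df (h x)) ->
  exists h' : {linear M -> mod_prod (inj_tails m J)},
    forall x j, y x j.+1 = is_df (inj_tails m J) j (h' x j).
Proof.
elim: m y => [|m ih] /= y hy; first by exists h => x j; rewrite hy.
have [h' hh'] := ih (lin_of (@tail_fun_linear (inj_tails m J)) \o y) hy.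
have h'l : linear
    (fun x => (fun j => h' x j.+1) : mod_prod (inj_tail (inj_tails m J))).
  by move=> a u v; apply: mod_prod_ext => j; rewrite linearP.
by exists (lin_of h'l) => x j; rewrite -(hh' x j.+1).
Qed.

(** With J an injective resolution of N, this says that s kills Ext^1(M, N),
    computed from J. *)
Definition lifts (s : R) (M : lmodType R) J :=
  forall f : {linear M -> J 1}, (forall x, is_df J 1 (f x) = 0) ->
    exists h : {linear M -> J 0}, forall x, s *: f x = is_df J 0 (h x).

(** Put f in the first component of the total complex of the (m+1)st truncation;
    it is a map from M in degree 0.  The null-homotopy of s f in the total
    complex of J has as component a map to the m-th term of J, which is
    the required h. *)
Lemma lifts_of_kills (s : R) (M : lmodType R) (hM : fin_gen M) m J :
  kills s m.+1 (stalk hM) -> lifts s M (inj_tails m J).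
Proof.
move=> kM f df0; set K := inj_tails m J in f df0 *.
pose y (x : M) : total (inj_tail K) :=
  fun j => match j with 0 => f x | _ => 0 end.
have yl : linear y.
  move=> a u v; apply: mod_prod_ext => -[|j] /=.
    exact: linearP.
  by rewrite -[RHS]/(a *: (0 : K j.+2) + 0) scaler0 addr0.
have dy x : total_df (y x) = 0.
  by apply: mod_prod_ext => -[|[|j]] //=; exact: linear0.
pose a (n : int) : {linear stalk_mod M n -> total (inj_tail K)} :=
  match n with Posz 0 => lin_of yl | _ => \0 end.
have ad n (x : stalk hM n) :
    a (n + 1) (df (stalk hM) n x) = dm_df (total (inj_tail K)) (a n x).
  rewrite /= linear0; case: n x => [[|n]|n] x; first exact/esym/dy.
    exact/esym/(linear0 (dm_df (total (inj_tail K)))).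
  exact/esym/(linear0 (dm_df (total (inj_tail K)))).
have gt : ghostly m.+1 (tails_mor m.+1 J) by exact: ghostly_tails_mor.
have [h hh] := kM _ _ _ gt (@Emap R (stalk hM) (total (inj_tail K)) a ad).
have [|h' hh'] := @tails_mor_boundary m J M
    (s \*: (lin_of (@tail_fun_linear K) \o lin_of yl)) (h 0).
  move=> x; have := hh 0 x; rewrite /= !linear0 !addr0 add0r => <-.
  by rewrite linearZ.
have h0l : linear (fun x => h' x 0%N) by move=> b u v; rewrite linearP.
by exists (lin_of h0l) => x; rewrite /= -(hh' x 0%N).
Qed.

(** Ext computed from P and from J agree, by exchanging one step of P for one
    step of J: a cocycle phi on P_(k+1) extends to a on P_k by injectivity,
    and d a is a cocycle on P_k with values in the next term of J.  If s d a is
    the coboundary of b, lift b through d to b' by projectivity; then s phi is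
    the coboundary of s a - (the coboundary of b').  At k = 0, the cocycle d a
    on P_0 comes from M, where [lifts] applies. *)
Lemma dimension_shift (s : R) (M : lmodType R) (P : proj_resolution M) J k j :
  lifts s M (inj_tails (k + j) J) ->
  forall phi : {linear P k.+1 -> inj_tails j J 0},
    (forall x, phi (pr_df P k.+1 x) = 0) ->
    (forall x, is_df (inj_tails j J) 0 (phi x) = 0) ->
  exists psi : {linear P k -> inj_tails j J 0},
    (forall x, is_df (inj_tails j J) 0 (psi x) = 0) /\
    forall x, s *: phi x = psi (pr_df P k x).
Proof.
have fact i (L : inj_sequence R) (phi : {linear P i.+1 -> L 0}) :
    (forall x, phi (pr_df P i.+1 x) = 0) ->
    exists a : {linear P i -> L 0}, forall x, a (pr_df P i x) = phi x.
  move=> phid; apply: (is_inj (j := 0)) => x /pr_exactS[y <-]; exact: phid.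
elim: k j => [|k ih] j hl phi phid dphi; have [a ha] := fact _ _ _ phid.
  rewrite add0n in hl; set L := inj_tails j J in hl phi phid dphi a ha *.
  have [x|f hf] := @is_inj R L 1 _ _ (pr_aug P) (is_df L 0 \o a).
    by move=> /pr_exact0[y <-] /=; rewrite ha dphi.
  have [|h hh] := hl f.
    move=> m; have [x <-] := pr_aug_surj P m.
    by rewrite hf /=; apply/is_exact; exists (a x).
  exists (s \*: a \- (h \o pr_aug P)); split=> x /=.
    by rewrite linearB linearZ /= -hh hf subrr.
  have aug0 : pr_aug P (pr_df P 0 x) = 0 by apply/pr_exact0; exists x.
  by rewrite ha aug0 linear0 subr0.
set L := inj_tails j J in phi phid dphi a ha *.
have hl' : lifts s M (inj_tails (k + j.+1) J) by rewrite addnS -addSn.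
have [x|x|b [db hb]] := ih j.+1 hl' (is_df L 0 \o a : {linear P k.+1 -> _}).
- by rewrite /= ha dphi.
- by rewrite /=; apply/is_exact; exists (a x).
have [x|b' hb'] := projective_lift (g := is_df L 0) (h := b) (@pr_proj _ _ P k).
  exact/is_exact/db.
exists (s \*: a \- (b' \o pr_df P k)); split=> x /=.
  by rewrite linearB linearZ /= hb' -hb /= subrr.
have dd0 : pr_df P k (pr_df P k.+1 x) = 0 by apply/pr_exactS; exists x.
by rewrite ha dd0 linear0 subr0.
Qed.

(** As N is the kernel of J_0 -> J_1, a cocycle with values in N is one with
    values in this kernel, and so is its primitive. *)
Lemma ann_Ext_of_kills (s : R) (M N : lmodType R) (hM : fin_gen M) d :
  (1 <= d)%N -> kills s d (stalk hM) -> ann (Ext d M N) s.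
Proof.
case: d => // k _ kM; rewrite /ann /= /Ext.
move: (std_resolution M) => P; elim/quo_ind => phi.
have [J [e [e0 eE]]] := injective_resolution N.
have := sub_valP phi; rewrite sm_predE inE => -[phil phid].
have hl : lifts s M (inj_tails (k + 0) J).
  by rewrite addn0; exact: lifts_of_kills kM.
have [x|x|psi [dpsi hpsi]] :=
    dimension_shift (P := P) (j := 0%N) hl
      (phi := (e \o lin_of phil : {linear P k.+1 -> _})).
- by rewrite /= phid linear0.
- by apply/eE; exists (sub_val phi x).
have [x|psi' hpsi'] := projective_lift (g := e) (h := psi) (@pr_proj _ _ P k).
  exact/eE/dpsi.
rewrite -[LHS]/(quo_scale s (quo_pi (coboundaries N P k.+1) phi)) quo_scaleE.
apply/quo_piP; rewrite subr0 inE /=; exists psi' => x.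
apply/eqP; rewrite -subr_eq0; apply/eqP/e0.
by rewrite linearB hpsi' -hpsi /= linearZ subrr.
Qed.

End TotalComplex.

Theorem theorem1p3 (R : idomainType) (hR : noetherian R)
    (T : tri_data) (hT : triangulated T) (n : nat)
    (hreg : regular T) (hdim : rouquier_dim T n)
    (F : tri_functor T (Db R))
    (I : Type) (M : I -> lmodType R) (hM : forall i, fin_gen (M i))
    (hF : forall i, in_ess_image F (stalk (hM i)))
    (d : nat) (hd : (1 <= d)%N) (N : I -> lmodType R)
    (hann : \bigcap_(i in [set: I]) ann (Ext d (M i) (N i)) = [set 0]) :
  (d <= n)%N.
Proof.
have [[G genG] _] := hdim.
rewrite leqNgt; apply/negP => nd.
have [s s0 kG] := kills_ghost (F G) hR.
have : (\bigcap_(i in [set: I]) ann (Ext d (M i) (N i))) (s ^+ n.+1).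
  move=> i _; have [X FX] := hF i.
  apply: (ann_Ext_of_kills (hM := hM i)) hd _ => E E' t gt.
  apply: ((kills_iso _ _ FX).1 (kills_generated kG (genG X))).
  exact: ghostly_weaken gt.
by rewrite hann /= => /eqP; rewrite expf_eq0 /= (negPf s0).
Qed.
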